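(* Let $T>0$ and $a>0$. Assume the following. (i) $\Phi:[-a,a]\to\mathbb{R}$ satisfies $\Phi\in C[-a,a]\cap C^1(-a,a)$, and $\phi:=\Phi':(-a,a)\to\mathbb{R}$ is an increasing homeomorphism (onto $\mathbb{R}$) with $\phi(0)=0$. (ii) $f:[0,T]\times\mathbb{R}\to\mathbb{R}$ is continuous, $\lim_{|s|\to+\infty}f(t,s)=0$ uniformly with respect to $t\in[0,T]$, and there exists $\alpha\in\mathbb{R}$ such that the primitive $F(t,\tau)=\int_0^\tau f(t,s)\,ds$ satisfies $\lim_{|s|\to+\infty}F(t,s)=\alpha$ uniformly with respect to $t\in[0,T]$. (iii) $h:[0,T]\to\mathbb{R}$ is continuous and $\int_0^T h(t)\,dt=0$. Then there exists at least one solution of the periodic problem $$\begin{cases}(\phi(u'(t)))'=f(t,u(t))+h(t), & t\in(0,T),\\ u(0)-u(T)=0=u'(0)-u'(T).\end{cases}$$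
   Context: A solution of the periodic problem is a function $u\in C^1[0,T]$ with $u(0)=u(T)$, $u'(0)=u'(T)$, such that $\|u'\|_\infty<a$, $\phi\circ u'$ is absolutely continuous on $[0,T]$, and $(\phi(u'))'(t)=f(t,u(t))+h(t)$ for a.e. $t\in(0,T)$. *)

(* Defs.v *)
From mathcomp Require Import all_boot all_order all_algebra.
From mathcomp Require Import all_classical all_reals all_analysis.

Set Implicit Arguments.
Unset Strict Implicit.
Unset Printing Implicit Defensive.

Import Order.TTheory GRing.Theory Num.Theory.
Import numFieldNormedType.Exports.

Local Open Scope classical_set_scope.
Local Open Scope ring_scope.

(* A function on a subset of R (or of R * R) is represented by a total function
   of which only the values on that subset are constrained or used. *)

(* The derivative relative to a set D: at an endpoint of an interval D it is
   the one-sided derivative. *)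
Definition diff_quot {R : realType} (u : R -> R) (t s : R) : R :=
  (u s - u t) / (s - t).

Definition derivable_within {R : realType} (D : set R) (u : R -> R) (t : R) :=
  cvg (diff_quot u t s @[s --> within D t^']).

Definition derive_within {R : realType} (D : set R) (u : R -> R) (t : R) : R :=
  lim (diff_quot u t s @[s --> within D t^']).

Definition C1_on {R : realType} (D : set R) (u : R -> R) :=
  (forall t, D t -> derivable_within D u t) /\
  {within D, continuous (derive_within D u)}.

(* sup of an unbounded set is 0 by convention: to be used for functions bounded
   on D only, such as continuous functions on a compact D. *)
Definition sup_norm {R : realType} (D : set R) (v : R -> R) : R :=
  sup [set `|v t| | t in D].

Definition absolutely_continuous {R : realType} (c d : R) (g : R -> R) :=
  forall e : R, 0 < e -> exists2 delta : R, 0 < delta &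
    forall (n : nat) (x y : 'I_n -> R),
      (forall i, c <= x i /\ x i <= y i /\ y i <= d) ->
      trivIset setT (fun i => `]x i, y i[%classic) ->
      \sum_(i < n) (y i - x i) < delta ->
      \sum_(i < n) `|g (y i) - g (x i)| < e.

Definition homeomorphism_on {R : realType} (A B : set R) (g : R -> R) :=
  {within A, continuous g} /\
  exists k : R -> R,
    [/\ {within B, continuous k},
        forall x, A x -> B (g x) /\ k (g x) = x &
        forall y, B y -> A (k y) /\ g (k y) = y].

(* The oriented integral from c to d, so that d < c is allowed. *)
Definition oriented_integral {R : realType} (c d : R) (g : R -> R) : R :=
  if c <= d then (\int[lebesgue_measure]_(s in `[c, d]) g s)%R
  else - (\int[lebesgue_measure]_(s in `[d, c]) g s)%R.

Definition primitive {R : realType} (f : R -> R -> R) (t tau : R) : R :=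
  oriented_integral 0 tau (f t).

(* g t s tends to l as |s| tends to +oo, uniformly in t \in D. *)
Definition cvg_abs_infty_unif {R : realType} (D : set R) (g : R -> R -> R)
    (l : R) :=
  forall e : R, 0 < e -> exists M : R,
    forall t s : R, D t -> M < `|s| -> `|g t s - l| < e.

Definition periodic_solution {R : realType} (T a : R) (phi : R -> R)
    (f : R -> R -> R) (h u : R -> R) :=
  let u' := derive_within `[0, T] u in
  [/\ C1_on `[0, T] u,
      u 0 = u T /\ u' 0 = u' T,
      sup_norm `[0, T] u' < a,
      absolutely_continuous 0 T (phi \o u') &
      {ae lebesgue_measure, forall t : R, `]0, T[%classic t ->
        is_derive t 1 (phi \o u') (f t (u t) + h t)}].

(* Main.v *)
Require Import Defs.
From HB Require Import structures.
From mathcomp Require Import all_boot all_order all_algebra.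
From mathcomp Require Import all_classical all_reals all_analysis.
From mathcomp Require Import ring lra.

(** Why the theorem holds.

    Write u = x + U with x = u(0) and U the primitive of v = u'. Solutions are
    critical points of

      I(x, v) = \int_0^T (Phi(v) + F(t, u) + h u) dt

    on the slopes v with zero mean, and because h has zero mean, I(x, v) splits
    as J(v) + \int_0^T F(t, u) dt, where J does not see x. When |x| goes to
    infinity the second term tends to alpha T, uniformly in v since |v| < a
    keeps U bounded. Hence inf J + alpha T is the only level at which
    almost critical points can escape to infinity, and there are three cases:
    some point lies strictly below this level, and a minimising sequence stays
    bounded; the infimum over v of I(0, v) is exactly this level and the level
    is a lower bound everywhere, so that points with x = 0 minimise; or, for
    some x0, the wall of all points over x0 lies strictly above the level, and
    every path from far on the left to far on the right has to climb over it,
    which gives almost critical points by a mountain pass argument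
    (mountain_pass, bounded_almost_critical).

    Descent is produced by a conditional gradient step: freeze the force
    e = f(t, u) + h along u, solve the convex problem
    (phi(y'))' = e - mean(e) exactly, which is explicit because
    y' = phi^-1(s + E) with E the primitive of e - mean(e) and s a constant
    fixed by \int y' = 0, then move u a fraction th of the way towards y while
    shifting x against the mean of e. The energy drops by th times a residual,
    up to o(th) uniformly in u (step_decrease). The residual is the divergence
    \int (Phi(v) - Phi(y') - phi(y') (v - y')) plus T mean(e)^2; it is
    nonnegative and vanishes only at solutions.

    Since y' is a function of e alone and |e| is bounded, y' stays in a compact
    subinterval of (-a, a); restricting all slopes to this interval removes the
    singularity of phi at the end points. Finally, let the residuals tend to 0
    along bounded base points. The trajectories are equi-Lipschitz, so they
    cluster uniformly at some u; sharpness of the divergence makes v and y'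
    close in L^1; and y' depends continuously on u. In the limit u' = y' and
    mean(e) = 0, which is the equation (critical_point). *)

Set Implicit Arguments.
Unset Strict Implicit.
Unset Printing Implicit Defensive.

Import Order.TTheory GRing.Theory Num.Theory.
Import numFieldNormedType.Exports.

Local Open Scope classical_set_scope.
Local Open Scope ring_scope.

(** * An integral calculus through antiderivatives *)

Section Pointwise.
Context {R : realType}.
Implicit Types f g : R -> R.

Lemma contD f g : continuous f -> continuous g ->
  continuous (fun x => f x + g x).
Proof. by move=> cf cg x; apply: continuousD; [exact: cf|exact: cg]. Qed.

Lemma contN f : continuous f -> continuous (fun x => - f x).
Proof. by move=> cf x; apply: continuousN; exact: cf. Qed.

Lemma contB f g : continuous f -> continuous g ->
  continuous (fun x => f x - g x).
Proof. by move=> cf cg; apply: contD => //; exact: contN. Qed.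

Lemma contM f g : continuous f -> continuous g ->
  continuous (fun x => f x * g x).
Proof. by move=> cf cg x; apply: continuousM; [exact: cf|exact: cg]. Qed.

Lemma cont_cst (k : R) : continuous (fun _ : R => k).
Proof. exact: cst_continuous. Qed.

Lemma cont_comp f g : continuous f -> continuous g ->
  continuous (fun x => f (g x)).
Proof. by move=> cf cg x; apply: continuous_comp; [exact: cg|exact: cf]. Qed.

End Pointwise.

(** Locked, so that unification treats an integral as an atom instead of
    unfolding the Lebesgue integral. *)
HB.lock Definition prim {R : realType} (g : R -> R) (t : R) : R :=
  oriented_integral 0 t g.

Section Primitive.
Context {R : realType}.
Implicit Types (g G : R -> R) (t : R).

Lemma continuous_integrable_itv g (a b : R) : continuous g ->
  lebesgue_measure.-integrable `[a, b] (EFin \o g).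
Proof.
move=> cg; apply: continuous_compact_integrable; first exact: segment_compact.
exact: continuous_subspaceT.
Qed.

Lemma prim_shift g (A t : R) : continuous g -> A <= 0 -> A <= t ->
  prim g t = (\int[lebesgue_measure]_(s in `[A, t]) g s)%R -
             (\int[lebesgue_measure]_(s in `[A, 0%R]) g s)%R.
Proof.
move=> cg A0 At; rewrite prim.unlock /oriented_integral; case: ifPn => [t0|].
  rewrite (@Rintegral_itvB _ g (BLeft A) (BRight t) 0) ?bnd_simp//.
    rewrite Rintegral_itv_obnd_cbnd//.
    apply: integrableS (continuous_integrable_itv 0 t cg) => //.
    exact: subset_itv_oc_cc.
  exact: continuous_integrable_itv.
rewrite -ltNge => t0.
rewrite -[RHS]opprB (@Rintegral_itvB _ g (BLeft A) (BRight 0) t) ?bnd_simp//.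
- rewrite Rintegral_itv_obnd_cbnd//.
  apply: integrableS (continuous_integrable_itv t 0 cg) => //.
  exact: subset_itv_oc_cc.
- exact: continuous_integrable_itv.
- exact: ltW.
Qed.

(** Moving the base point to the left of both 0 and t turns the oriented
    integral into a difference of integrals over intervals with a common left
    end, to which the fundamental theorem applies at the interior point t. *)
Lemma is_derive_prim g t : continuous g -> is_derive t 1 (prim g) (g t).
Proof.
move=> cg; pose A : R := - (`|t| + 1).
have At : A < t by rewrite /A ltrNl -normrN (le_lt_trans (ler_norm _))// ltrDl.
have A0 : A <= 0 by rewrite /A oppr_le0 addr_ge0.
pose c := (\int[lebesgue_measure]_(s in `[A, 0%R]) g s)%R.
pose F (x : R) := (\int[lebesgue_measure]_(s in `[A, x]) g s)%R.
have dF : is_derive t 1 F (g t).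
  have [dF' F'E] : derivable F t 1 /\ derive1 F t = g t.
    apply: (@continuous_FTC1_closed _ g A t (t + 1)).
    - by rewrite ltrDl.
    - exact: continuous_integrable_itv.
    - exact: At.
    - exact: cg.
  by rewrite -F'E derive1E; exact: DeriveDef.
have dFc : is_derive t 1 (F - cst c) (g t).
  by apply: is_derive_eq; rewrite subr0.
apply: near_eq_is_derive dFc; near=> x; rewrite (@prim_shift _ A)//.
apply: ltW; near: x; exact: lt_nbhsr.
Unshelve. all: by end_near. Qed.

Lemma prim0 g : prim g 0 = 0.
Proof. by rewrite prim.unlock /oriented_integral lexx set_itv1 Rintegral_set1.
  Qed.

Lemma derive_continuous G g :
  (forall t, is_derive t 1 G (g t)) -> continuous G.
Proof.
move=> dG t; apply: differentiable_continuous; apply/derivable1_diffP.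
by have [] := dG t.
Qed.

Lemma continuous_prim g : continuous g -> continuous (prim g).
Proof. by move=> cg; apply: derive_continuous => t; exact: is_derive_prim. Qed.

Lemma primE G g t : continuous g -> (forall x : R, is_derive x 1 G (g x)) ->
  prim g t = G t - G 0.
Proof.
move=> cg dG.
have d0 (x : R) : is_derive x 1 (prim g - G) 0.
  by have dp := is_derive_prim x cg; apply: is_derive_eq; rewrite subrr.
have := is_derive_0_is_cst t 0 d0; rewrite !fctE prim0 sub0r => /eqP.
by rewrite subr_eq addrC => /eqP.
Qed.

Lemma primD g1 g2 t : continuous g1 -> continuous g2 ->
  prim (fun s => g1 s + g2 s) t = prim g1 t + prim g2 t.
Proof.
move=> c1 c2; have d (x : R) : is_derive x 1 (prim g1 + prim g2) (g1 x + g2 x).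
  by apply: is_deriveD; exact: is_derive_prim.
rewrite (primE _ _ d) ?fctE ?prim0 ?addr0 ?subr0//.
exact: contD.
Qed.

Lemma primZ g (k : R) t : continuous g ->
  prim (fun s => k * g s) t = k * prim g t.
Proof.
move=> cg; have d (x : R) : is_derive x 1 (k \*: prim g) (k * g x).
  by apply: is_deriveZ; exact: is_derive_prim.
rewrite (primE _ _ d)/= ?prim0 ?scaler0 ?subr0//.
by apply: contM => //; exact: cont_cst.
Qed.

Lemma primN g t : continuous g -> prim (fun s => - g s) t = - prim g t.
Proof.
move=> cg; rewrite -mulN1r -primZ//; congr prim.
by apply/funext => s; rewrite mulN1r.
Qed.

Lemma primB g1 g2 t : continuous g1 -> continuous g2 ->
  prim (fun s => g1 s - g2 s) t = prim g1 t - prim g2 t.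
Proof.
move=> c1 c2; rewrite primD ?primN//; exact: contN.
Qed.

Lemma prim_cst (k : R) t : prim (cst k) t = k * t.
Proof.
have d (x : R) : is_derive x 1 (k \*: id) (cst k x).
  by apply: is_derive_eq; rewrite /GRing.scale/= mulr1.
by rewrite (primE _ _ d)/= ?scaler0 ?subr0//; exact: cst_continuous.
Qed.

(** The mean value theorem turns every comparison of integrals of continuous
    functions into a pointwise comparison. *)
Lemma prim_mean g (T : R) : 0 < T -> continuous g ->
  exists2 c, 0 <= c <= T & prim g T = g c * T.
Proof.
move=> T0 cg; have d x : x \in `]0, T[%R -> is_derive x 1 (prim g) (g x).
  by move=> _; exact: is_derive_prim.
have [c] := MVT T0 d (continuous_subspaceT (continuous_prim cg)).
rewrite in_itv/= => /andP[/ltW c0 /ltW cT]; rewrite prim0 !subr0 => E.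
by exists c; rewrite ?c0.
Qed.

Lemma prim_by_parts g1 g2 (T : R) : continuous g1 -> continuous g2 ->
  prim (fun s => prim g1 s * g2 s) T =
  prim g1 T * prim g2 T - prim (fun s => g1 s * prim g2 s) T.
Proof.
move=> c1 c2.
have cp1 := continuous_prim c1; have cp2 := continuous_prim c2.
have cA : continuous (fun s => prim g1 s * g2 s).
  exact: contM.
have cB : continuous (fun s => g1 s * prim g2 s).
  exact: contM.
have d (x : R) : is_derive x 1 (prim g1 * prim g2)
    (prim g1 x * g2 x + g1 x * prim g2 x).
  have d1 := is_derive_prim x c1; have d2 := is_derive_prim x c2.
  by apply: is_derive_eq; rewrite /GRing.scale/= [_ * g1 x]mulrC.
have -> : prim g1 T * prim g2 T = prim
    (fun s => prim g1 s * g2 s + g1 s * prim g2 s) T.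
  by rewrite (primE _ (contD cA cB) d) !fctE !prim0 mul0r subr0.
by rewrite primD// addrK.
Qed.

End Primitive.

Section IntegralBounds.
Context {R : realType}.
Implicit Types (g : R -> R) (t T : R).

Lemma prim_ge0 g T : 0 < T -> continuous g ->
  (forall t, 0 <= t <= T -> 0 <= g t) -> 0 <= prim g T.
Proof.
move=> T0 cg g0; have [c c0T ->] := prim_mean T0 cg.
by apply: mulr_ge0; [exact: g0|exact: ltW].
Qed.

Lemma prim_gt0 g T : 0 < T -> continuous g ->
  (forall t, 0 <= t <= T -> 0 < g t) -> 0 < prim g T.
Proof.
move=> T0 cg g0; have [c c0T ->] := prim_mean T0 cg.
by apply: mulr_gt0 => //; exact: g0.
Qed.

Lemma le_prim g1 g2 T : 0 < T -> continuous g1 -> continuous g2 ->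
  (forall t, 0 <= t <= T -> g1 t <= g2 t) -> prim g1 T <= prim g2 T.
Proof.
move=> T0 c1 c2 g12; rewrite -subr_ge0 -primB//.
by apply: prim_ge0 => //; [exact: contB|move=> t /g12; rewrite subr_ge0].
Qed.

Lemma lt_prim g1 g2 T : 0 < T -> continuous g1 -> continuous g2 ->
  (forall t, 0 <= t <= T -> g1 t < g2 t) -> prim g1 T < prim g2 T.
Proof.
move=> T0 c1 c2 g12; rewrite -subr_gt0 -primB//.
by apply: prim_gt0 => //; [exact: contB|move=> t /g12; rewrite subr_gt0].
Qed.

Lemma norm_prim_le g t T (B : R) : continuous g -> 0 <= t <= T ->
  (forall s, 0 <= s <= T -> `|g s| <= B) -> `|prim g t| <= B * t.
Proof.
move=> cg /andP[]; rewrite le_eqVlt => /predU1P[<- _ _|t0 tT gB].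
  by rewrite prim0 normr0 mulr0.
have [c /andP[c0 ct] ->] := prim_mean t0 cg.
by rewrite normrM (gtr0_norm t0) ler_pM2r// gB// c0 (le_trans ct).
Qed.

Lemma prim_lipschitz g (B x y : R) : continuous g -> (forall s, `|g s| <= B) ->
  `|prim g x - prim g y| <= B * `|x - y|.
Proof.
move=> cg gB; wlog : x y / y < x => [H|yx].
  have [yx|xy|->] := ltgtP y x; [exact: H| |].
    by rewrite distrC [`|x - y|]distrC; exact: H.
  by rewrite !subrr !normr0 mulr0.
have d z : z \in `]y, x[%R -> is_derive z 1 (prim g) (g z).
  by move=> _; exact: is_derive_prim.
have [c _ ->] := MVT yx d (continuous_subspaceT (continuous_prim cg)).
by rewrite normrM ler_wpM2r.
Qed.

End IntegralBounds.

Lemma le_norm_prim (R : realType) (g G : R -> R) (t T : R) : 0 < T ->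
  continuous g -> continuous G -> (forall s, 0 <= s <= T -> `|g s| <= G s) ->
  0 <= t <= T -> `|prim g t| <= prim G T.
Proof.
move=> T0 cg cG gG /andP[t0 tT].
have G0 s : 0 <= s <= T -> 0 <= G s by move=> /gG; exact: le_trans.
have Gt : prim G t <= prim G T.
  move: tT; rewrite le_eqVlt => /predU1P[->//|tT].
  have d x : x \in `]t, T[%R -> is_derive x 1 (prim G) (G x).
    by move=> _; exact: is_derive_prim.
  have [x] := MVT tT d (continuous_subspaceT (continuous_prim cG)).
  rewrite in_itv/= -subr_ge0 => /andP[tx xT] ->; rewrite mulr_ge0//.
    by rewrite G0// (le_trans t0) ltW.
  by rewrite subr_ge0 ltW.
apply: le_trans Gt; move: t0; rewrite le_eqVlt => /predU1P[<-|t0].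
  by rewrite !prim0 normr0.
rewrite ler_norml -primN//; apply/andP; split; apply: le_prim => //.
- exact: contN.
- move=> s /andP[s0 st]; have := gG s; rewrite s0 (le_trans st tT) => /(_ isT).
  by rewrite ler_norml => /andP[].
- move=> s /andP[s0 st]; have := gG s; rewrite s0 (le_trans st tT) => /(_ isT).
  by rewrite ler_norml => /andP[].
Qed.


(** * Uniformity on compact sets *)

Section Compactness.
Context {R : realType}.

(** Only the first point ranges over the compact set: divergence_sharp compares
    it with points that may lie outside. *)
Lemma heine_cantor (X : pseudoMetricType R) (A : set X) (g : X -> R) (e : R) :
  compact A -> continuous g -> 0 < e -> exists2 d, 0 < d &
  forall x y, A x -> ball x d y -> `|g x - g y| < e.
Proof.
move=> cA cg e0; have e20 : 0 < e / 2 by rewrite divr_gt0.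
have /compact_near_coveringP/(_ R (at_right 0)
  (fun d x => forall y, ball x d y -> `|g x - g y| < e)) H := cA.
have [] := H _.
  move=> x Ax; have /cvgrPdist_lt/(_ _ e20)/nbhs_ballP[r /= r0 Hr] := cg x.
  have r20 : 0 < r / 2 by rewrite divr_gt0.
  exists (ball x (r / 2), [set d | 0 < d <= r / 2]) => /=.
    split; first exact: nbhsx_ballx.
    near=> d; apply/andP; split; near: d; first exact: nbhs_right_gt.
    exact: nbhs_right_le.
  move=> [x' d] /= [xx' /andP[d0 dr]] y x'y.
  have xr : ball x r x' by apply: le_ball xx'; lra.
  have yr : ball x r y.
    by rewrite (splitr r); apply: ball_triangle xx' (le_ball dr x'y).
  have -> : g x' - g y = (g x - g y) - (g x - g x') by ring.
  rewrite (le_lt_trans (ler_normB _ _))// (splitr e) ltrD//; exact: Hr.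
move=> r /= r0 Hr; exists (r / 2); first by rewrite divr_gt0.
move=> x y Ax; apply: (Hr (r / 2)) => //=; last by rewrite divr_gt0.
by rewrite sub0r normrN gtr0_norm ?divr_gt0//; lra.
Unshelve. all: by end_near. Qed.

Lemma continuous_compact_bounded (X : pseudoMetricType R) (A : set X)
  (g : X -> R) : compact A -> continuous g ->
  exists2 b, 0 <= b & forall x, A x -> `|g x| <= b.
Proof.
move=> cA cg.
have /compact_near_coveringP/(_ R (+oo) (fun b x => `|g x| <= b)) H := cA.
have [] := H _.
  move=> x Ax; have /cvgrPdist_lt/(_ _ ltr01) Hx := cg x.
  exists ([set y | `|g x - g y| < 1], [set b | `|g x| + 1 <= b]) => /=.
    by split=> //; exact: nbhs_pinfty_ge.
  move=> [y b] /= [xy xb]; have := ler_normB (g x) (g x - g y).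
  by rewrite opprB addrC subrK; lra.
move=> b [_ Hb]; exists (`|b| + 1); first by rewrite addr_ge0.
move=> x Ax; apply: Hb => //.
by rewrite (le_lt_trans (ler_norm b))// ltrDl.
Qed.

End Compactness.

Lemma within_dist (R : realType) (X : pseudoMetricType R) (A : set X)
  (g : X -> R) : {within A, continuous g} -> forall x e, A x -> 0 < e ->
  exists2 d, 0 < d & forall y, A y -> ball x d y -> `|g x - g y| < e.
Proof.
move=> /subspace_continuousP cg x e Ax e0.
have /cvgrPdist_lt/(_ _ e0) := cg x Ax.
move=> /nbhs_ballP[d /= d0 Hd]; exists d => // y Ay xy; exact: Hd.
Qed.

(** A subsequence-free form of the Arzela-Ascoli theorem: the pointwise limit
    along an ultrafilter exists by compactness of bounded intervals, and the
    common Lipschitz constant makes the convergence uniform on a finite net. *)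
Lemma lipschitz_cluster (R : realType) (c M T : R) (u : nat -> R -> R) :
  0 < T -> 0 < c -> (forall n s t, `|u n s - u n t| <= c * `|s - t|) ->
  (forall n, `|u n 0| <= M) ->
  exists2 l : R -> R, (forall s t, `|l s - l t| <= c * `|s - t|) &
  forall e N, 0 < e -> exists2 n, (N <= n)%N &
    forall t, 0 <= t <= T -> `|u n t - l t| < e.
Proof.
move=> T0 c0 ulip u0.
have [G [GU GN]] := @ultraFilterLemma nat \oo _.
have GP : ProperFilter G by exact: ultra_proper.
have ubound n t : - (M + c * `|t|) <= u n t <= M + c * `|t|.
  rewrite -ler_norml; have := ulip n t 0; rewrite subr0.
  have := ler_normD (u n t - u n 0) (u n 0); rewrite subrK.
  by have := u0 n; lra.
have cvgu t : exists l : R, forall e, 0 < e -> G [set n | `|u n t - l| < e].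
  have GA : G ((fun n => u n t) @^-1` `[- (M + c * `|t|), M + c * `|t|]).
    by apply: filterS filterT => n _ /=; rewrite in_itv/=.
  have [l [_ cl]] := segment_compact (fmap_proper_filter (fun n =>
    u n t) GP) GA.
  exists l => e e0; pose V := [set x : R | `|x - l| < e].
  have [//|GV] := in_ultra_setVsetC ((fun n => u n t) @^-1` V) GU.
  have Vl : nbhs l V.
    apply/nbhs_ballP; exists e => //= x; rewrite /ball/= /V/= distrC//.
  by have [x [/= nVx Vx]] := cl (~` V) V GV Vl.
have [l Hl] := choice cvgu.
have llip s t : `|l s - l t| <= c * `|s - t|.
  apply/ler_addgt0Pl => e e0.
  have e2 : 0 < e / 2 by rewrite divr_gt0.
  have [n [/= ns nt]] := filter_ex (filterI (Hl s _ e2) (Hl t _ e2)).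
  have -> : l s - l t = (u n s - u n t) - (u n s - l s) + (u n t - l t) by ring.
  have := ler_normD (u n s - u n t - (u n s - l s)) (u n t - l t).
  have := ler_normB (u n s - u n t) (u n s - l s).
  have := ulip n s t; lra.
exists l => // e N e0; have e3 : 0 < e / 3 by rewrite divr_gt0.
(* The mesh T / k is fine enough for both Lipschitz functions to vary by less
   than e / 3 on a cell. *)
pose k := (Num.bound (3 * c * T / e)).+1.
have k0 : (0 : R) < k%:R by rewrite ltr0n.
have ck : c * (T / k%:R) < e / 3.
  have : 3 * c * T / e < k%:R.
    rewrite /k (lt_le_trans (archi_boundP _)) ?ler_nat//.
    by apply: divr_ge0; [rewrite !mulr_ge0// ltW|exact: ltW].
  rewrite ltr_pdivrMr// => H.
  by rewrite mulrA ltr_pdivrMr//; lra.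
have Gnet : G [set n | forall i : 'I_k.+1,
    `|u n (i%:R * (T / k%:R)) - l (i%:R * (T / k%:R))| < e / 3].
  by apply: filter_forall => i; exact: Hl.
have GNn : G [set n | (N <= n)%N] by apply: GN; exact: nbhs_infty_ge.
have [n [/= net Nn]] := filter_ex (filterI Gnet GNn).
exists n => // t /andP[t0 tT].
have Tk : 0 < T / k%:R by rewrite divr_gt0.
pose x := t / (T / k%:R).
have x0 : 0 <= x by rewrite divr_ge0// ltW.
have xk : x <= k%:R.
  by rewrite ler_pdivrMr// mulrC divfK// gt_eqF.
have /andP[ix xi] := truncn_itv x0.
have ik : (Num.trunc x < k.+1)%N.
  by rewrite ltnS -(ler_nat R) (le_trans ix).
have := net (Ordinal ik); rewrite /=.
set ti := _ * (T / k%:R) => neti.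
have tti : `|t - ti| <= T / k%:R.
  have -> : t - ti = (x - (Num.trunc x)%:R) * (T / k%:R).
    by rewrite mulrBl /x divfK// gt_eqF.
  rewrite normrM (gtr0_norm Tk) ger0_norm ?subr_ge0//.
  apply: ler_piMl; first exact: ltW.
  by rewrite lerBlDl -natr1 addrC in xi *; exact: ltW.
have -> : u n t - l t = (u n t - u n ti) - (l t - l ti) + (u n ti - l ti) by
  ring.
have := ler_normD (u n t - u n ti - (l t - l ti)) (u n ti - l ti).
have := ler_normB (u n t - u n ti) (l t - l ti).
have := ulip n t ti; have := llip t ti.
have : c * `|t - ti| <= c * (T / k%:R) by rewrite ler_wpM2l// ltW.
by lra.
Qed.

(** * The reduced problem and the shape of a trajectory *)

(** What the variational argument needs of the periodic problem, once
    - time is clamped to [0, T], so that all functions are continuous on the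
      whole line and integrals are values of antiderivatives;
    - the force f(t, s) + h(t) is bounded by B, so that phi(y') = s + E(t), for
      every y' of interest, is bounded by 4 B T: both the primitive E of a
      mean-free force and the constant s that balances it are at most 2 B T;
    - the inverse of phi is cut off outside [- 4 B T, 4 B T]; this is the field
      slope, whose bound speed is thus strictly below the singular value a.
    The divergence kinetic q - kinetic p - phi(p) (q - p) is written with
    p = slope x and x = phi(p), so that phi itself does not occur. *)
Record reduced_problem (R : realType) := ReducedProblem {
  period : R;
  speed : R;
  force_bound : R;
  slope : R -> R;
  kinetic : R -> R;
  nonlinearity : R -> R -> R;
  forcing : R -> R;
  potential_limit : R;
  period_gt0 : 0 < period;
  speed_gt0 : 0 < speed;
  force_bound_ge0 : 0 <= force_bound;
  slope_unif : forall e, 0 < e -> exists2 d, 0 < d &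
    forall x y, `|x - y| < d -> `|slope x - slope y| < e;
  slope0 : slope 0 = 0;
  slope_incr : forall x y, - (4 * force_bound * period) <= x -> x < y ->
    y <= 4 * force_bound * period -> slope x < slope y;
  slope_bound : forall x, `|slope x| <= speed;
  kinetic_cont : forall v : R -> R, continuous v -> (forall t,
    `|v t| <= speed) ->
    continuous (fun t => kinetic (v t));
  kinetic_convex : forall th p q, 0 <= th <= 1 -> `|p| <= speed ->
    `|q| <= speed ->
    kinetic (p + th * (q - p)) <= kinetic p + th * (kinetic q - kinetic p);
  kinetic_tangent : forall q x, `|q| <= speed ->
    `|x| <= 4 * force_bound * period ->
    kinetic (slope x) + x * (q - slope x) <= kinetic q;
  kinetic_sharp : forall e, 0 < e -> exists2 C, 0 <= C & forall q x,
    `|q| <= speed -> `|x| <= 4 * force_bound * period ->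
    `|q - slope x| <=
      e + C * (kinetic q - kinetic (slope x) - x * (q - slope x));
  nonlin_unif : forall e, 0 < e -> exists2 d, 0 < d & forall t t' s s',
    `|t - t'| < d -> `|s - s'| < d ->
    `|nonlinearity t s - nonlinearity t' s'| < e;
  nonlin_bound : forall t s, `|nonlinearity t s| <= force_bound;
  nonlin_vanish : forall e, 0 < e -> exists M, forall t s,
    M < `|s| -> `|nonlinearity t s| < e;
  potential_cvg : forall e, 0 < e -> exists M, forall t s,
    M < `|s| -> `|prim (nonlinearity t) s - potential_limit| < e;
  forcing_cont : continuous forcing;
  forcing_mean0 : prim forcing period = 0;
  force_le : forall t s, `|nonlinearity t s + forcing t| <= force_bound
}.

Definition force {R : realType} (P : reduced_problem R) (u : R -> R) (t : R) :=
  nonlinearity P t (u t) + forcing P t.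

Definition mean {R : realType} (P : reduced_problem R) (u : R -> R) :=
  prim (force P u) (period P) / period P.

(** It vanishes at both ends of the period, hence so do the boundary terms of
    every integration by parts. *)
Definition moment {R : realType} (P : reduced_problem R) (u : R -> R) :=
  prim (fun t => force P u t - mean P u).

(** The integration constant for which the trajectory with derivative
    slope (shift + moment) closes up; unique because slope is increasing on the
    range of its arguments. *)
HB.lock Definition shift {R : realType} (P : reduced_problem R) (u : R -> R) :
  R :=
  xget 0 [set s | `|s| <= 2 * force_bound P * period P /\
    prim (fun t => slope P (s + moment P u t)) (period P) = 0].

Section Shape.
Variables (R : realType) (P : reduced_problem R).
Local Notation T := (period P).
Local Notation c := (speed P).
Local Notation B := (force_bound P).
Local Notation K := (slope P).
Local Notation f := (nonlinearity P).
Local Notation h := (forcing P).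
Local Notation force := (force P).
Local Notation mean := (mean P).
Local Notation moment := (moment P).
Local Notation shift := (shift P).
Implicit Types (u v E : R -> R) (t s : R).

(** The derivative of the periodic y with (phi(y'))' = force u - mean u. As the
    minimiser of the energy with the force frozen at u, it is the direction of
    descent from u. *)
Definition shape u t := K (shift u + moment u t).

Lemma slope_cont : continuous K.
Proof.
move=> x; apply/cvgrPdist_lt => e /(slope_unif P)[d d0 H].
by near=> y; apply: H; near: y; apply: cvgr_dist_lt.
Unshelve. all: by end_near. Qed.

Lemma nonlin_cont u : continuous u -> continuous (fun t => f t (u t)).
Proof.
move=> cu t; apply/cvgrPdist_lt => e /(nonlin_unif P)[d d0 H].
near=> t'; apply: H.
  by near: t'; apply: cvgr_dist_lt.
by near: t'; move/cvgrPdist_lt: (cu t); exact.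
Unshelve. all: by end_near. Qed.

Lemma force_cont u : continuous u -> continuous (force u).
Proof. by move=> cu; apply: contD;
  [exact: nonlin_cont|exact: forcing_cont]. Qed.

Lemma mean_bound u : continuous u -> `|mean u| <= B.
Proof.
move=> cu; have T0 := period_gt0 P.
rewrite normrM normfV (gtr0_norm T0) ler_pdivrMr//.
apply: (@norm_prim_le _ _ T T _ (force_cont cu)); first by rewrite lexx ltW.
by move=> s _; exact: force_le.
Qed.

Lemma moment_cont u : continuous u -> continuous (moment u).
Proof.
move=> cu; apply: continuous_prim; apply: contB; [exact: force_cont|].
exact: cont_cst.
Qed.

Lemma moment_bound u t : continuous u -> 0 <= t <= T ->
  `|moment u t| <= 2 * B * T.
Proof.
move=> cu tT; have := mean_bound cu => mB.
have cg : continuous (fun t => force u t - mean u).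
  by apply: contB; [exact: force_cont|exact: cont_cst].
apply: (@le_trans _ _ (2 * B * t)).
  apply: (norm_prim_le cg tT) => s _.
  rewrite (le_trans (ler_normB _ _))// mulrDl mul1r lerD//.
  exact: force_le.
case/andP: tT => _ tT; apply: ler_wpM2l => //.
by rewrite mulr_ge0 ?force_bound_ge0.
Qed.

Lemma moment_per u : continuous u -> moment u T = 0.
Proof.
move=> cu; have T0 := period_gt0 P.
rewrite /moment primB ?prim_cst; [|exact: force_cont|exact: cont_cst].
by rewrite /mean divfK ?subrr// gt_eqF.
Qed.

Lemma slope_shift_cont E s : continuous E -> continuous (fun t => K (s + E t)).
Proof.
move=> cE; apply: (cont_comp slope_cont); apply: contD => //; exact: cont_cst.
Qed.

Lemma shift_argument s x : `|s| <= 2 * B * T -> `|x| <= 2 * B * T ->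
  - (4 * B * T) <= s + x <= 4 * B * T.
Proof.
rewrite !ler_norml => /andP[s1 s2] /andP[x1 x2].
have -> : 4 * B * T = 2 * B * T + 2 * B * T by ring.
by rewrite opprD !lerD.
Qed.

(** Beyond 2 B T the constant dominates the moment, so the slope has a constant
    sign and the mean slope changes sign in between. *)
Lemma shiftP u : continuous u -> `|shift u| <= 2 * B * T /\
  prim (shape u) T = 0.
Proof.
move=> cu; have T0 := period_gt0 P; have B0 := force_bound_ge0 P.
have cE := moment_cont cu; have EB t := @moment_bound u t cu.
suff [s] : exists s, `|s| <= 2 * B * T /\
    prim (fun t => K (s + moment u t)) T = 0.
  by move=> sP; rewrite /shape shift.unlock; case: xgetP => [y _ //|] /(_ s).
pose A := 2 * B * T; pose g s := prim (fun t => K (s + moment u t)) T.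
have A0 : 0 <= A by rewrite /A !mulr_ge0// ltW.
have cg : continuous g.
  move=> s; apply/cvgrPdist_le => e e0.
  have eT : 0 < e / T by rewrite divr_gt0.
  have [d d0 H] := slope_unif P eT.
  near=> s'; rewrite /g -primB; [|exact: slope_shift_cont..].
  rewrite -[leRHS](divfK (lt0r_neq0 T0)).
  apply: (@norm_prim_le _ _ _ T).
  - by apply: contB; exact: slope_shift_cont.
  - by rewrite lexx ltW.
  move=> t _; apply/ltW/H.
  have -> : s + moment u t - (s' + moment u t) = s - s' by ring.
  by near: s'; apply: cvgr_dist_lt.
have AA : - A <= A by rewrite ge0_cp.
have nA : `|A| <= 2 * B * T by rewrite ger0_norm.
have nNA : `|- A| <= 2 * B * T by rewrite normrN.
have KA x : 0 <= x <= 4 * B * T -> 0 <= K x.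
  move=> /andP[]; rewrite le_eqVlt => /predU1P[<- _|x0 xA];
    first by rewrite slope0.
  rewrite -(slope0 P) ltW// slope_incr// oppr_le0.
  by rewrite !mulr_ge0// ltW.
have KNA x : - (4 * B * T) <= x <= 0 -> K x <= 0.
  move=> /andP[xA]; rewrite le_eqVlt => /predU1P[->|x0];
    first by rewrite slope0.
  rewrite -(slope0 P) ltW// slope_incr// !mulr_ge0// ltW//.
have [||s] := @IVT _ g (- A) A 0 AA.
- exact: continuous_subspaceT.
- have gA : 0 <= g A.
    apply: prim_ge0 => // [|t /EB Et]; first exact: slope_shift_cont.
    have /andP[_ AE] := shift_argument nA Et; apply: KA; rewrite AE andbT.
    by move: Et; rewrite ler_norml => /andP[Et _]; rewrite -lerBlDl sub0r.
  have gNA : g (- A) <= 0.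
    rewrite -oppr_ge0 -primN; last exact: slope_shift_cont.
    apply: prim_ge0 => // [|t /EB Et]; first exact/contN/slope_shift_cont.
    rewrite oppr_ge0; apply: KNA.
    have /andP[AE _] := shift_argument nNA Et; rewrite AE /=.
    by move: Et; rewrite ler_norml => /andP[_ Et]; rewrite addrC subr_le0.
  by rewrite ge_min gNA le_max gA orbT.
- rewrite in_itv/= -ler_norml => sA gs.
  by exists s.
Unshelve. all: by end_near. Qed.

Lemma shape_cont u : continuous u -> continuous (shape u).
Proof. by move=> /moment_cont cE; exact: slope_shift_cont. Qed.

Lemma shape_bound u t : `|shape u t| <= c.
Proof. exact: slope_bound. Qed.

Lemma shape_argument u t : continuous u -> 0 <= t <= T ->
  `|shift u + moment u t| <= 4 * B * T.
Proof.
move=> cu tT; have [sB _] := shiftP cu.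
by rewrite ler_norml; apply: shift_argument => //; exact: moment_bound.
Qed.

(** If one shift exceeded the other by more than the distance of the moments,
    one slope would be strictly above the other, and they could not both have
    mean zero. *)
Lemma shift_le u1 u2 (d : R) : continuous u1 -> continuous u2 ->
  (forall t, 0 <= t <= T -> `|moment u1 t - moment u2 t| <= d) ->
  shift u1 - shift u2 <= d.
Proof.
move=> c1 c2 Ed; rewrite leNgt; apply/negP => dlt.
have [_ i1] := shiftP c1; have [_ i2] := shiftP c2.
suff : prim (shape u2) T < prim (shape u1) T by rewrite i1 i2 ltxx.
apply: lt_prim; [exact: period_gt0|exact: shape_cont..|] => t tT.
have := shape_argument c1 tT; have := shape_argument c2 tT.
rewrite !ler_norml => /andP[x1 x2] /andP[y1 y2].
apply: slope_incr => //; move: (Ed t tT) dlt.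
rewrite ler_norml => /andP[]; lra.
Qed.

(** Uniformity over all u, rather than mere continuity, lets the same modulus
    serve along a sequence and at its limit. *)
Lemma shape_unif (e : R) : 0 < e -> exists2 d, 0 < d & forall u1 u2,
  continuous u1 -> continuous u2 ->
  (forall t, 0 <= t <= T -> `|u1 t - u2 t| < d) ->
  `|mean u1 - mean u2| <= e /\
  (forall t, 0 <= t <= T -> `|shape u1 t - shape u2 t| < e).
Proof.
move=> e0; have T0 := period_gt0 P; have [dK dK0 HK] := slope_unif P e0.
pose e1 := Num.min e (dK / (8 * T)).
have e10 : 0 < e1 by rewrite lt_min e0 divr_gt0 ?mulr_gt0.
have [d d0 Hd] := nonlin_unif P e10; exists d => // u1 u2 c1 c2 u12.
have fc1 := force_cont c1; have fc2 := force_cont c2.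
have g12 t : 0 <= t <= T -> `|force u1 t - force u2 t| <= e1.
  move=> tT; rewrite /force.
  have -> : f t (u1 t) + h t - (f t (u2 t) + h t) = f t (u1 t) - f t (u2 t).
    by ring.
  by rewrite ltW// Hd ?subrr ?normr0//; exact: u12.
have m12 : `|mean u1 - mean u2| <= e1.
  rewrite -mulrBl -primB// normrM normfV (gtr0_norm T0) ler_pdivrMr//.
  by apply: (@norm_prim_le _ _ T T) (contB fc1 fc2) _ g12; rewrite lexx ltW.
have E12 t : 0 <= t <= T -> `|moment u1 t - moment u2 t| <= 2 * e1 * T.
  move=> tT; have cc1 := contB fc1 (@cont_cst _ (mean u1)).
  have cc2 := contB fc2 (@cont_cst _ (mean u2)).
  rewrite -primB//; apply: (@le_trans _ _ (2 * e1 * t)).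
    apply: (norm_prim_le (contB cc1 cc2) tT) => s sT.
    have -> : force u1 s - mean u1 - (force u2 s - mean u2) =
      (force u1 s - force u2 s) - (mean u1 - mean u2) by ring.
    by rewrite (le_trans (ler_normB _ _))// mulrDl mul1r lerD// g12.
  by case/andP: tT => _ tT; apply: ler_wpM2l => //; rewrite mulr_ge0// ltW.
have s12 : `|shift u1 - shift u2| <= 2 * e1 * T.
  rewrite ler_norml lerNl opprB; apply/andP; split; apply: shift_le => // t tT.
  by rewrite distrC E12.
split=> [|t tT]; first by rewrite (le_trans m12)// ge_min lexx.
apply: HK.
have -> : shift u1 + moment u1 t - (shift u2 + moment u2 t) =
  (shift u1 - shift u2) + (moment u1 t - moment u2 t) by ring.
apply: (le_lt_trans (ler_normD _ _)).
apply: (le_lt_trans (lerD s12 (E12 t tT))).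
have : e1 <= dK / (8 * T) by rewrite ge_min lexx orbT.
rewrite ler_pdivlMr ?mulr_gt0// => H.
apply: (@le_lt_trans _ _ (dK / 2)); last by lra.
by move: H; lra.
Qed.

End Shape.

(** * The energy and one descent step *)

Section Energy.
Variables (R : realType) (P : reduced_problem R).
Local Notation T := (period P).
Local Notation c := (speed P).
Local Notation B := (force_bound P).
Local Notation Phi := (kinetic P).
Local Notation f := (nonlinearity P).
Local Notation h := (forcing P).
Local Notation force := (force P).
Local Notation mean := (mean P).
Local Notation moment := (moment P).
Local Notation shift := (shift P).
Local Notation shape := (shape P).
Implicit Types (u v w : R -> R) (t s : R).

Definition admissible v :=
  [/\ continuous v, forall t, `|v t| <= c & prim v T = 0].

Local Notation adm := admissible.

Definition traj (x : R) v t : R := x + prim v t.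

Definition energy (x : R) v : R :=
  prim (fun t => Phi (v t)) T + prim (fun t => prim (f t) (traj x v t)) T +
  prim (fun t => h t * traj x v t) T.

(** The Bregman divergence of the kinetic energy between v and shape u, with
    phi (shape u) written as shift u + moment u. *)
Definition bregman u v t : R :=
  Phi (v t) - Phi (shape u t) - (shift u + moment u t) * (v t - shape u t).

(** The gap between the linearised energy at the point and its minimum in v,
    plus the squared gradient in the direction of constants. *)
Definition residual (x : R) v : R :=
  prim (bregman (traj x v) v) T + T * mean (traj x v) ^+ 2.

(** Velocity of the base point: the last term subtracts the average of the
    displacement caused by the change of slope, so that the trajectory moves
    on average by minus the mean force, a gradient step along constants. *)
Definition drift (x : R) v : R := - mean (traj x v) -
  prim (prim (fun t => shape (traj x v) t - v t)) T / T.

Definition next_base (th x : R) v : R := x + th * drift x v.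

Definition next_slope (th x : R) v t : R :=
  v t + th * (shape (traj x v) t - v t).

Lemma nonlin_slice_cont t : continuous (f t).
Proof.
move=> s; apply/cvgrPdist_lt => e /(nonlin_unif P)[d d0 H].
near=> s'; apply: H; first by rewrite subrr normr0.
by near: s'; apply: cvgr_dist_lt.
Unshelve. all: by end_near. Qed.

Lemma potential_lip t s s' : `|prim (f t) s - prim (f t) s'| <= B * `|s - s'|.
Proof.
by apply: prim_lipschitz; [exact: nonlin_slice_cont|move=> r;
  exact: nonlin_bound].
Qed.

Lemma potential_cont u : continuous u -> continuous (fun t => prim (f t) (u t)).
Proof.
move=> cu t; apply/cvgrPdist_le => e e0.
pose k := e / (2 * (`|u t| + 1)); have ut0 : 0 < `|u t| + 1 by rewrite ltr_wpDl.
have k0 : 0 < k by rewrite divr_gt0// mulr_gt0.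
have [d d0 H] := nonlin_unif P k0.
have eB : 0 < e / (2 * (B + 1)).
  by rewrite divr_gt0// mulr_gt0// ltr_wpDl// force_bound_ge0.
near=> t'.
have -> : prim (f t) (u t) - prim (f t') (u t') =
  (prim (f t) (u t) - prim (f t') (u t)) +
  (prim (f t') (u t) - prim (f t') (u t')) by ring.
rewrite (le_trans (ler_normD _ _))// (splitr e) lerD//.
  rewrite -primB; [|exact: nonlin_slice_cont..].
  have c12 := contB (@nonlin_slice_cont t) (@nonlin_slice_cont t').
  have ftt' r : `|f t r - f t' r| <= k.
    by apply/ltW/H; [near: t'; apply: cvgr_dist_lt|rewrite subrr normr0].
  have := prim_lipschitz (u t) 0 c12 ftt'; rewrite prim0 !subr0 => /le_trans.
  apply; rewrite /k.
  have -> : e / (2 * (`|u t| + 1)) * `|u t| = (e / 2) * (`|u t| / (`|u t| + 1)).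
    by field; rewrite lt0r_neq0.
  apply: ler_piMr; first by rewrite divr_ge0// ltW.
  by rewrite ler_pdivrMr// mul1r lerDl.
rewrite (le_trans (potential_lip _ _ _))//.
apply: (@le_trans _ _ ((B + 1) * (e / (2 * (B + 1))))); last first.
  have B1 : B + 1 != 0 by rewrite lt0r_neq0// ltr_wpDl// force_bound_ge0.
  suff -> : (B + 1) * (e / (2 * (B + 1))) = e / 2 by [].
  by field.
apply: ler_pM => //; rewrite ?force_bound_ge0 ?lerDl//.
by apply: ltW; near: t'; move/cvgrPdist_lt: (cu t); exact.
Unshelve. all: by end_near. Qed.

(** A one-sided Taylor expansion whose remainder is uniform because the force
    is uniformly continuous on the whole strip; it replaces a Lipschitz bound
    on f. *)
Lemma potential_expand (e : R) : 0 < e -> exists2 d, 0 < d & forall t s r,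
  `|r| < d ->
  prim (f t) (s + r) <= prim (f t) s + f t s * r + e * `|r|.
Proof.
move=> e0; have [d d0 H] := nonlin_unif P e0; exists d => // t s r rd.
have cft := @nonlin_slice_cont t; pose g x := f t x - f t s.
have Hg x : `|x - s| < d -> `|g x| <= e.
  by move=> xs; apply/ltW/H => //; rewrite subrr normr0.
suff : `|prim (f t) (s + r) - prim (f t) s - f t s * r| <= e * `|r|.
  by rewrite ler_norml => /andP[_]; lra.
have key a b : a < b -> (forall x, a <= x <= b -> `|x - s| < d) ->
    `|prim (f t) b - prim (f t) a - f t s * (b - a)| <= e * (b - a).
  move=> ab abd.
  have dF x : x \in `]a, b[%R -> is_derive x 1 (prim (f t)) (f t x).
    by move=> _; exact: is_derive_prim.
  have [x] := MVT ab dF (continuous_subspaceT (continuous_prim cft)).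
  rewrite in_itv/= => /andP[/ltW ax /ltW xb] ->; rewrite -mulrBl normrM.
  rewrite (@gtr0_norm _ (b - a)) ?subr_gt0// ler_pM2r ?subr_gt0//.
  by apply: Hg; apply: abd; rewrite ax.
have [r0|r0|->] := ltgtP r 0; last first.
- by rewrite addr0 mulr0 subr0 subrr normr0 mulr0.
- have rE := gtr0_norm r0; have := key s (s + r).
  rewrite (_ : s + r - s = r) ?rE; last by ring.
  apply; first by rewrite ltrDl.
  move=> x /andP[sx xs]; rewrite ger0_norm ?subr_ge0//.
  by rewrite (le_lt_trans _ rd)// rE lerBlDl.
- have rE := ltr0_norm r0; have H' := key (s + r) s.
  rewrite (_ : s - (s + r) = `|r|) in H'; last by rewrite rE; ring.
  rewrite -normrN.
  have -> : - (prim (f t) (s + r) - prim (f t) s - f t s * r) =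
    prim (f t) s - prim (f t) (s + r) - f t s * `|r| by rewrite rE; ring.
  apply: H'; first by rewrite gtrDl.
  move=> x /andP[sx xs]; rewrite distrC ger0_norm ?subr_ge0//.
  rewrite (le_lt_trans _ rd)// rE; move: sx; lra.
Qed.

Lemma traj_cont (x : R) v : adm v -> continuous (traj x v).
Proof.
by case=> cv _ _; apply: contD; [exact: cont_cst|exact: continuous_prim].
Qed.

Lemma slope_diff_cont (x : R) v : adm v ->
  continuous (fun t => shape (traj x v) t - v t).
Proof.
move=> av; have [cv _ _] := av.
by apply: contB => //; exact/shape_cont/traj_cont.
Qed.

Lemma prim_slope_diff (x : R) v t : adm v ->
  prim (fun t => shape (traj x v) t - v t) t =
  prim (shape (traj x v)) t - prim v t.
Proof.
move=> av; have [cv _ _] := av.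
by rewrite primB//; exact/shape_cont/traj_cont.
Qed.

Lemma prim_adm_bound v t : adm v -> 0 <= t <= T -> `|prim v t| <= c * T.
Proof.
move=> [cv vc _] tT; apply: (@le_trans _ _ (c * t)).
  by apply: (norm_prim_le cv tT) => s _; exact: vc.
by case/andP: tT => _ tT; rewrite ler_wpM2l// ltW ?speed_gt0.
Qed.

Lemma shape_adm u : continuous u -> adm (shape u).
Proof.
move=> cu; split; first exact: shape_cont.
  by move=> t; exact: shape_bound.
by have [] := shiftP P cu.
Qed.

Lemma prim_slope_diff_bound (x : R) v t : adm v -> 0 <= t <= T ->
  `|prim (fun t => shape (traj x v) t - v t) t| <= 2 * c * T.
Proof.
move=> av tT; rewrite prim_slope_diff// (le_trans (ler_normB _ _))//.
rewrite -mulrA mulrDl mul1r lerD// prim_adm_bound//.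
exact/shape_adm/traj_cont.
Qed.

Lemma drift_bound (x : R) v : adm v -> `|drift x v| <= B + 2 * c * T.
Proof.
move=> av; have T0 := period_gt0 P; rewrite /drift (le_trans (ler_normB _ _))//.
rewrite normrN lerD//; first exact/mean_bound/traj_cont.
rewrite normrM normfV (gtr0_norm T0) ler_pdivrMr//.
apply: (@norm_prim_le _ _ T T); first exact/continuous_prim/slope_diff_cont.
  by rewrite lexx ltW.
by move=> s; exact: prim_slope_diff_bound.
Qed.

Lemma next_slope_adm (th x : R) v : 0 <= th <= 1 -> adm v ->
  adm (next_slope th x v).
Proof.
move=> /andP[th0 th1] av; have [cv vc v0] := av.
have cd := @slope_diff_cont x v av.
split.
- by apply: contD => //; apply: contM => //; exact: cont_cst.
- move=> t; rewrite /next_slope.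
  have -> : v t + th * (shape (traj x v) t - v t) =
    (1 - th) * v t + th * shape (traj x v) t by ring.
  rewrite (le_trans (ler_normD _ _))//
    !normrM (ger0_norm th0) ger0_norm ?subr_ge0//.
  rewrite (_ : c = (1 - th) * c + th * c); last by ring.
  rewrite lerD// ler_wpM2l ?subr_ge0//; exact: shape_bound.
- rewrite /next_slope primD//; last by apply: contM => //; exact: cont_cst.
  rewrite primZ// prim_slope_diff// v0.
  by have [_ _ ->] := shape_adm (@traj_cont x v av); rewrite subrr mulr0 addr0.
Qed.

Lemma traj_next (th x : R) v t : adm v ->
  traj (next_base th x v) (next_slope th x v) t = traj x v t +
  th * (drift x v + prim (fun t => shape (traj x v) t - v t) t).
Proof.
move=> av; have [cv _ _] := av; have cd := @slope_diff_cont x v av.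
rewrite {1}/traj /next_slope primD//; last by apply: contM => //;
  exact: cont_cst.
by rewrite primZ// /next_base /traj; ring.
Qed.

(** Integrating by parts trades the mean-free part of the force for its moment,
    which the mean-free slopes allow to complete by the shift; the drift cancels
    the remaining mixed term and leaves minus the squared mean. *)
Lemma force_work (x : R) v : adm v ->
  prim (fun t => force (traj x v) t *
    (drift x v + prim (fun t => shape (traj x v) t - v t) t)) T =
  - prim (fun t => (shift (traj x v) + moment (traj x v) t) *
    (shape (traj x v) t - v t)) T - T * mean (traj x v) ^+ 2.
Proof.
move=> av; have [cv _ v0] := av; have T0 := period_gt0 P.
have cu := @traj_cont x v av; have cd := @slope_diff_cont x v av.
have := prim_slope_diff x T av; have := erefl (drift x v).
rewrite {2}/drift; have [_ _ ->] := shape_adm cu; rewrite v0 subrr.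
move: (drift x v) cd; set u := traj x v in cu *; set y := fun t => _ - v t.
move=> D cy DE yT.
have cg := @force_cont _ P _ cu; set m := mean u in DE *.
have cgm : continuous (fun t => force u t - m) by apply: contB => //;
  exact: cont_cst.
have cZ := continuous_prim cy; have cE := @moment_cont _ P _ cu.
have gT : prim (force u) T = m * T by rewrite /m /mean divfK// gt_eqF.
transitivity (prim (fun t => prim y t * (force u t - m) +
    (m * prim y t + D * force u t)) T).
  by congr prim; apply/funext => t; ring.
have cZg := contM cZ cgm; have cmZ := contM (@cont_cst _ m) cZ.
have cDg := contM (@cont_cst _ D) cg.
rewrite primD//; last exact: contD.
rewrite primD// !primZ// prim_by_parts// yT mul0r sub0r gT -/(moment u).
have cyE : continuous (fun t => y t * moment u t) by exact: contM.
have cEy : continuous (fun t => moment u t * y t) by exact: contM.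
have cSy := contM (@cont_cst _ (shift u)) cy.
transitivity (- (prim (fun t => shift u * y t) T +
    prim (fun t => moment u t * y t) T) - T * m ^+ 2); last first.
  rewrite -primD//; congr (- prim _ _ - _).
  by apply/funext => t; rewrite mulrDl.
rewrite primZ// yT mulr0 add0r.
have -> : prim (fun t => y t * moment u t) T = prim (fun t =>
  moment u t * y t) T.
  by congr prim; apply/funext => t; rewrite mulrC.
by rewrite DE; field; rewrite gt_eqF.
Qed.

End Energy.

Section Step.
Variables (R : realType) (P : reduced_problem R).
Local Notation T := (period P).
Local Notation c := (speed P).
Local Notation B := (force_bound P).
Local Notation Phi := (kinetic P).
Local Notation f := (nonlinearity P).
Local Notation h := (forcing P).
Local Notation force := (force P).
Local Notation mean := (mean P).
Local Notation moment := (moment P).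
Local Notation shift := (shift P).
Local Notation shape := (shape P).
Local Notation adm := (admissible P).
Local Notation energy := (energy P).
Local Notation bregman := (bregman P).
Local Notation residual := (residual P).
Local Notation drift := (drift P).
Local Notation next_base := (next_base P).
Local Notation next_slope := (next_slope P).
Implicit Types (u v w : R -> R) (t s : R).

Definition lagrangian (x : R) v t : R :=
  Phi (v t) + prim (f t) (traj x v t) + h t * traj x v t.

Lemma kinetic_adm_cont v : adm v -> continuous (fun t => Phi (v t)).
Proof. by case=> cv vc _; exact: kinetic_cont. Qed.

Lemma lagrangian_cont (x : R) v : adm v -> continuous (lagrangian x v).
Proof.
move=> av; have cu := @traj_cont _ P x v av.
apply: contD; first by apply: contD;
  [exact: kinetic_adm_cont|exact: potential_cont].
by apply: contM => //; exact: forcing_cont.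
Qed.

Lemma energyE (x : R) v : adm v -> energy x v = prim (lagrangian x v) T.
Proof.
move=> av; have cu := @traj_cont _ P x v av.
have c1 := kinetic_adm_cont av; have c2 := @potential_cont _ P _ cu.
have c3 := contM (@forcing_cont _ P) cu.
by rewrite /lagrangian primD ?primD//; exact: contD.
Qed.

Lemma bregman_cont u v : continuous u -> adm v -> continuous (bregman u v).
Proof.
move=> cu av; have [cv _ _] := av; have cS := @shape_cont _ P _ cu.
apply: contB; first by apply: contB; apply: kinetic_adm_cont => //;
  exact: shape_adm.
apply: contM; last exact: contB.
by apply: contD; [exact: cont_cst|exact: moment_cont].
Qed.

Lemma bregman_ge0 u v t : continuous u -> adm v -> 0 <= t <= T ->
  0 <= bregman u v t.
Proof.
move=> cu [_ vc _] tT.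
have := @kinetic_tangent _ P (v t) (shift u + moment u t).
by rewrite /bregman -addrA -opprD subr_ge0; apply;
  [exact: vc|exact: shape_argument].
Qed.

Lemma residual_ge0 (x : R) v : adm v -> 0 <= residual x v.
Proof.
move=> av; have cu := @traj_cont _ P x v av; have T0 := period_gt0 P.
apply: addr_ge0; last by rewrite mulr_ge0 ?sqr_ge0// ltW.
apply: prim_ge0 => //; first exact: bregman_cont.
by move=> t tT; exact: bregman_ge0.
Qed.

(** Convexity bounds the kinetic part by the chord and potential_expand bounds
    the potential part by the work of the frozen force; by force_work the two
    first-order terms add up to minus the residual. *)
Lemma step_decrease (e : R) : 0 < e -> exists2 th0, 0 < th0 <= 1 &
  forall th x v, 0 <= th <= th0 -> adm v ->
  energy (next_base th x v) (next_slope th x v) <=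
  energy x v - th * (residual x v - e).
Proof.
move=> e0; have T0 := period_gt0 P; have c0 := speed_gt0 P;
  have B0 := force_bound_ge0 P.
(* D bounds the displacement W of the trajectory per unit of th. *)
pose D := B + 4 * c * T.
have D0 : 0 < D by rewrite ltr_wpDl// !mulr_gt0.
have e'0 : 0 < e / (D * T) by rewrite divr_gt0// mulr_gt0.
have [d d0 Fd] := potential_expand P e'0.
exists (Num.min 1 (d / (2 * D))) => [|th x v].
  by rewrite ge_min lexx lt_min ltr01 divr_gt0// mulr_gt0.
rewrite le_min => /and3P[th0 th1 thd] av; have [cv vc v0] := av.
have cu := @traj_cont _ P x v av; have cd := @slope_diff_cont _ P x v av.
have aS : adm (shape (traj x v)) by exact: shape_adm.
have aN : adm (next_slope th x v) by apply: next_slope_adm; rewrite ?th0.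
pose W t := drift x v + prim (fun t => shape (traj x v) t - v t) t.
have WD t : 0 <= t <= T -> `|W t| <= D.
  move=> tT; rewrite /W (le_trans (ler_normD _ _))//.
  rewrite (_ : D = (B + 2 * c * T) + 2 * c * T); last by rewrite /D; ring.
  by rewrite lerD ?drift_bound ?prim_slope_diff_bound.
have cW : continuous W by apply: contD;
  [exact: cont_cst|exact: continuous_prim].
have thWd t : 0 <= t <= T -> `|th * W t| < d.
  move=> tT; rewrite normrM (ger0_norm th0).
  apply: (@le_lt_trans _ _ (d / (2 * D) * D)); first by apply: ler_pM => //;
    exact: WD.
  rewrite (_ : d / (2 * D) * D = d / 2); last by field; rewrite gt_eqF.
  by lra.
pose V t := (Phi (shape (traj x v) t) - Phi (v t)) + force (traj x v) t * W t.
have cPd : continuous (fun t => Phi (shape (traj x v) t) - Phi (v t)).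
  by apply: contB; exact: kinetic_adm_cont.
have cfW : continuous (fun t => force (traj x v) t * W t).
  by apply: contM => //; exact: force_cont.
have cV : continuous V by exact: contD.
have cVe : continuous (fun t => th * (V t + e / T)).
  by apply: contM; [exact: cont_cst|apply: contD => //; exact: cont_cst].
have -> : energy x v - th * (residual x v - e) =
    prim (fun t => lagrangian x v t + th * (V t + e / T)) T.
  rewrite primD//; last exact: lagrangian_cont.
  rewrite primZ; last by apply: contD => //; exact: cont_cst.
  rewrite primD//; last exact: cont_cst.
  rewrite prim_cst divfK ?gt_eqF// -energyE// /V primD// force_work//.
  have cx : continuous (fun t => (shift (traj x v) + moment (traj x v) t) *
      (shape (traj x v) t - v t)).
    by apply: contM => //; apply: contD; [exact: cont_cst|exact: moment_cont].
  rewrite /residual.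
  have -> : prim (bregman (traj x v) v) T =
     prim (fun t => (shift (traj x v) + moment (traj x v) t) *
      (shape (traj x v) t - v t)) T -
      prim (fun t => Phi (shape (traj x v) t) - Phi (v t)) T.
    rewrite -primB//; congr prim; apply/funext => t; rewrite /bregman; ring.
  by ring.
rewrite energyE//; apply: le_prim => //.
- exact: lagrangian_cont.
- by apply: contD => //; exact: lagrangian_cont.
move=> t tT; rewrite /lagrangian traj_next// -/(W t).
have th01 : 0 <= th <= 1 by rewrite th0.
have HP := @kinetic_convex _ P th (v t) (shape (traj x v) t) th01 (vc t)
  (shape_bound P _ _).
have HF := Fd t (traj x v t) (th * W t) (thWd t tT).
have eW : e / (D * T) * `|th * W t| <= th * (e / T).
  rewrite normrM (ger0_norm th0).
  rewrite (_ : e / (D * T) * (th * `|W t|) = th * (e / T) * (`|W t| / D)).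
    apply: ler_piMr; first by rewrite mulr_ge0 ?divr_ge0// ltW.
    by rewrite ler_pdivrMr// mul1r WD.
  by field; rewrite !gt_eqF.
rewrite /V /force.
move: HP HF eW; rewrite /next_slope.
move: (Phi _) (Phi _) (Phi _) (prim _ _) (prim _ _) => p1 p2 p3 q1 q2.
move: (`|_|) => n.
move: (f t (traj x v t)) (h t) (W t) (e / T) (e / (D * T)) (traj x v t).
move=> a b w k l u.
by lra.
Qed.

(** Distances are measured on trajectories, not on slopes: the step sees v only
    through its primitive, except in the affine combination itself. *)
Lemma next_traj_unif (th e : R) : 0 <= th <= 1 -> 0 < e -> exists2 d, 0 < d &
  forall x v x' v', adm v -> adm v' ->
  (forall t, 0 <= t <= T -> `|traj x v t - traj x' v' t| < d) ->
  forall t, 0 <= t <= T ->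
  `|traj (next_base th x v) (next_slope th x v) t -
    traj (next_base th x' v') (next_slope th x' v') t| < e.
Proof.
move=> /andP[th0 th1] e0; have T0 := period_gt0 P.
pose e1 := e / (4 * (1 + 2 * T)).
have T1 : 0 < 1 + 2 * T by rewrite addr_gt0// mulr_gt0.
have e10 : 0 < e1 by rewrite divr_gt0// mulr_gt0.
have [d1 d10 Hd] := shape_unif P e10.
pose d := Num.min d1 (e / 20); exists d.
  by rewrite lt_min d10 divr_gt0.
move=> x v x' v' av av' uu' t tT.
have cu := @traj_cont _ P x v av; have cu' := @traj_cont _ P x' v' av'.
set u := traj x v in uu' cu *; set u' := traj x' v' in uu' cu' *.
have [|mm SS] := Hd u u' cu cu'.
  by move=> s /uu'/lt_le_trans; apply; rewrite ge_min lexx.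
have de : d <= e / 20 by rewrite ge_min lexx orbT.
have TT : 0 <= T <= T by rewrite lexx ltW.
have cS := @shape_cont _ P _ cu; have cS' := @shape_cont _ P _ cu'.
have ZZ s : 0 <= s <= T -> `|prim (fun t => shape u t - v t) s -
    prim (fun t => shape u' t - v' t) s| <= e1 * T + 2 * d.
  move=> sT; rewrite !prim_slope_diff//.
  have -> : prim (shape u) s - prim v s - (prim (shape u') s - prim v' s) =
    (prim (shape u) s - prim (shape u') s) + (u 0 - u' 0) - (u s - u' s).
    by rewrite /u /u' /traj !prim0; ring.
  have us : `|u s - u' s| <= d := ltW (uu' s sT).
  have u0 : `|u 0 - u' 0| <= d by apply: ltW; apply: uu'; rewrite lexx ltW.
  rewrite (_ : e1 * T + 2 * d = e1 * T + d + d); last by ring.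
  apply: (le_trans (ler_normB _ _)); apply: lerD => //.
  apply: (le_trans (ler_normD _ _)); apply: lerD => //.
  rewrite -primB//; apply: (@le_trans _ _ (e1 * s)).
    apply: (norm_prim_le (contB cS cS') sT) => r rT; exact/ltW/SS.
  by case/andP: sT => _ sT; rewrite ler_wpM2l// ltW.
have cd := @slope_diff_cont _ P x v av;
  have cd' := @slope_diff_cont _ P x' v' av'.
have DD : `|drift x v - drift x' v'| <= e1 + (e1 * T + 2 * d).
  rewrite /drift -/u -/u'.
  have cZ := continuous_prim cd; have cZ' := continuous_prim cd'.
  have -> : - mean u - prim (prim (fun t => shape u t - v t)) T / T -
      (- mean u' - prim (prim (fun t => shape u' t - v' t)) T / T) =
      - (mean u - mean u') - (prim (fun s => prim (fun t => shape u t - v t) s -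
        prim (fun t => shape u' t - v' t) s) T) / T.
    rewrite primB//; ring.
  rewrite (le_trans (ler_normB _ _))// normrN lerD//.
  rewrite normrM normfV (gtr0_norm T0) ler_pdivrMr//.
  by apply: (norm_prim_le (contB cZ cZ') TT).
rewrite !traj_next// -/u -/u'.
have -> : u t + th * (drift x v + prim (fun t => shape u t - v t) t) -
   (u' t + th * (drift x' v' + prim (fun t => shape u' t - v' t) t)) =
   (u t - u' t) + th * ((drift x v - drift x' v') +
    (prim (fun t => shape u t - v t) t - prim (fun t => shape u' t - v' t) t)).
  by ring.
apply: (le_lt_trans (ler_normD _ _)).
apply: (@lt_le_trans _ _ (d + (e1 + (e1 * T + 2 * d) + (e1 * T + 2 * d)))).
  apply: ltr_leD; first exact: uu'.
  rewrite normrM (ger0_norm th0) (le_trans (ler_piMl _ th1))//.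
  by rewrite (le_trans (ler_normD _ _))// lerD// ZZ.
have -> : d + (e1 + (e1 * T + 2 * d) + (e1 * T + 2 * d)) =
  5 * d + e1 * (1 + 2 * T) by ring.
rewrite (_ : e1 * (1 + 2 * T) = e / 4); last by rewrite /e1; field;
  rewrite gt_eqF.
by lra.
Qed.

End Step.

(** * Behaviour of the energy at infinity *)

Section MountainPass.
Variables (R : realType) (P : reduced_problem R).
Local Notation T := (period P).
Local Notation c := (speed P).
Local Notation B := (force_bound P).
Local Notation Phi := (kinetic P).
Local Notation f := (nonlinearity P).
Local Notation h := (forcing P).
Local Notation force := (force P).
Local Notation mean := (mean P).
Local Notation moment := (moment P).
Local Notation shift := (shift P).
Local Notation shape := (shape P).
Local Notation adm := (admissible P).
Local Notation energy := (energy P).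
Local Notation bregman := (bregman P).
Local Notation residual := (residual P).
Local Notation next_base := (next_base P).
Implicit Types (u v w : R -> R) (t s : R).

(** The part J of the energy that is left when the potential is removed; the
    constant x drops out because the forcing has mean zero. *)
Definition shape_energy v : R :=
  prim (fun t => Phi (v t)) T + prim (fun t => h t * prim v t) T.

Local Notation potential x v :=
  (prim (fun t => prim (f t) (traj x v t)) T).

Lemma energy_split (x : R) v : adm v ->
  energy x v = shape_energy v + potential x v.
Proof.
move=> av; have [cv _ _] := av; have ch := @forcing_cont _ P.
have cU := continuous_prim cv.
rewrite /energy /shape_energy.
have -> : prim (fun t => h t * traj x v t) T =
    prim (fun t => x * h t + h t * prim v t) T.
  by congr prim; apply/funext => t; rewrite /traj; ring.
rewrite primD; [|by apply: contM => //; exact: cont_cst|exact: contM].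
by rewrite primZ// forcing_mean0 mulr0 add0r; ring.
Qed.

Lemma energy_far (e : R) : 0 < e -> exists M, forall x v, adm v -> M < `|x| ->
  `|energy x v - (shape_energy v + potential_limit P * T)| <= e.
Proof.
move=> e0; have T0 := period_gt0 P.
have [M HM] := potential_cvg P (divr_gt0 e0 T0);
  exists (M + c * T) => x v av Mx.
have cF := potential_cont (@traj_cont _ P x v av).
rewrite energy_split// opprD addrACA subrr add0r -prim_cst -primB//; last first.
  exact: cont_cst.
rewrite -[leRHS](divfK (lt0r_neq0 T0)).
apply: (@norm_prim_le _ _ T T); first by apply: contB => //; exact: cont_cst.
  by rewrite lexx ltW.
move=> t tT; apply/ltW/HM; rewrite /traj.
have Ut := prim_adm_bound av tT.
have := ler_normB (x + prim v t) (prim v t); rewrite addrK; lra.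
Qed.

Lemma potential_bound (x : R) v : adm v ->
  `|potential x v| <= B * (`|x| + c * T) * T.
Proof.
move=> av; have T0 := period_gt0 P;
  have cF := potential_cont (@traj_cont _ P x v av).
apply: (@norm_prim_le _ _ T T) => //; first by rewrite lexx ltW.
move=> t tT; have := potential_lip P t (traj x v t) 0;
  rewrite prim0 !subr0 => /le_trans.
apply; rewrite ler_wpM2l ?force_bound_ge0// (le_trans (ler_normD _ _))// lerD//.
exact: prim_adm_bound.
Qed.

Lemma shape_energy_lower : exists m, forall v, adm v -> m <= shape_energy v.
Proof.
have T0 := period_gt0 P; have B0 := force_bound_ge0 P; have c0 := speed_gt0 P.
exists (Phi 0 * T - 2 * B * (c * T) * T) => v av; have [cv vc _] := av.
rewrite lerD//.
  rewrite -prim_cst; apply: le_prim => //; first exact: cont_cst.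
    exact: kinetic_adm_cont.
  move=> t _; have := @kinetic_tangent _ P (v t) 0 (vc t).
  by rewrite slope0 mul0r addr0 normr0 => ->//; rewrite !mulr_ge0// ltW.
have hB t : `|h t| <= 2 * B.
  have -> : h t = (f t 0 + h t) - f t 0 by ring.
  rewrite (le_trans (ler_normB _ _))//
    mulrDl mul1r lerD ?force_le ?nonlin_bound//.
have : `|prim (fun t => h t * prim v t) T| <= 2 * B * (c * T) * T.
  apply: (@norm_prim_le _ _ T T).
  - by apply: contM; [exact: forcing_cont|exact: continuous_prim].
  - by rewrite lexx ltW.
  - move=> t tT; rewrite normrM ler_pM//; exact: prim_adm_bound.
by rewrite ler_norml => /andP[].
Qed.

(** When the base point is far away, the force is almost h, so a point with a
    small residual almost minimises the part of the energy that does not see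
    the potential. *)
Lemma shape_energy_far (e : R) : 0 < e -> exists M, forall x v w,
  adm v -> adm w -> M < `|x| ->
  shape_energy v <= shape_energy w + residual x v + e.
Proof.
move=> e0; have T0 := period_gt0 P; have c0 := speed_gt0 P.
pose k := e / (4 * c * T ^+ 2).
have k0 : 0 < k by rewrite divr_gt0// !mulr_gt0 ?exprn_gt0.
have [M HM] := nonlin_vanish P k0; exists (M + c * T) => x v w av aw Mx.
have [cv vc v0] := av; have [cw wc w0] := aw.
have cu := @traj_cont _ P x v av; set u := traj x v in cu.
have cg := @force_cont _ P _ cu; have cE := @moment_cont _ P _ cu.
have cf := @nonlin_cont _ P _ cu; have ch := @forcing_cont _ P.
have TT : 0 <= T <= T by rewrite lexx ltW.
have fk t : 0 <= t <= T -> `|f t (u t)| <= k.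
  move=> tT; apply/ltW/HM; have Ut := prim_adm_bound av tT; rewrite /u /traj.
  have := ler_normB (x + prim v t) (prim v t); rewrite addrK; lra.
have mk : `|mean u| <= k.
  rewrite /mean /force primD// forcing_mean0 addr0.
  rewrite normrM normfV (gtr0_norm T0) ler_pdivrMr//.
  exact: (@norm_prim_le _ _ T T).
have cvw := contB cv cw; have cU := continuous_prim cv.
have cW := continuous_prim cw; have cUW := contB cU cW.
have cgm : continuous (fun t => force u t - mean u).
  by apply: contB => //; exact: cont_cst.
have cPv := kinetic_adm_cont av; have cPw := kinetic_adm_cont aw.
have cbr := bregman_cont cu av.
have csE : continuous (fun t => shift u + moment u t).
  by apply: contD => //; exact: cont_cst.
pose N t := (mean u - f t (u t)) * (prim v t - prim w t).
have cN : continuous N.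
  by apply: contM => //; apply: contB => //; exact: cont_cst.
have Nle : prim N T <= e.
  apply: (le_trans (ler_norm _)).
  rewrite (_ : e = 2 * k * (2 * (c * T)) * T); last first.
    by rewrite /k; field; rewrite !gt_eqF.
  apply: (@norm_prim_le _ _ T T) => // t tT; rewrite normrM ler_pM//.
    by rewrite (le_trans (ler_normB _ _))// mulrDl mul1r lerD// fk.
  by rewrite (le_trans (ler_normB _ _))// mulrDl mul1r lerD//;
    exact: prim_adm_bound.
have parts : prim (fun t => (shift u + moment u t) * (v t - w t)) T =
    - prim (fun t => (force u t - mean u) * (prim v t - prim w t)) T.
  have cMD : continuous (fun t => moment u t * (v t - w t)) by exact: contM.
  have cSD : continuous (fun t => shift u * (v t - w t)).
    by apply: contM => //; exact: cont_cst.
  transitivity (prim (fun t => shift u * (v t - w t) +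
      moment u t * (v t - w t)) T).
    by congr prim; apply/funext => t; rewrite mulrDl.
  have vwT : prim (fun t => v t - w t) T = 0 by rewrite primB// v0 w0 subrr.
  rewrite primD// primZ// vwT mulr0 add0r.
  rewrite prim_by_parts// vwT mulr0 sub0r.
  congr (- prim _ _); apply/funext => t; rewrite primB//.
have cA : continuous (fun t => (shift u + moment u t) * (v t - w t)).
  exact: contM.
have chU := contM ch cU; have chW := contM ch cW.
have chUW := contM ch cUW; have cgUW := contM cgm cUW.
have Phi_vw : prim (fun t => Phi (v t) - Phi (w t)) T <=
    prim (bregman u v) T +
    prim (fun t => (shift u + moment u t) * (v t - w t)) T.
  rewrite -primD//; apply: le_prim => //; [exact: contB|exact: contD|].
  move=> t tT; have := @kinetic_tangent _ P (w t) (shift u + moment u t) (wc t)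
    (shape_argument cu tT).
  by rewrite -/(shape u t) /bregman; lra.
have hUW : prim (fun t => h t * prim v t) T - prim (fun t => h t * prim w t) T -
    prim (fun t => (force u t - mean u) * (prim v t - prim w t)) T = prim N T.
  rewrite -primB// -primB//; last exact: contB.
  by congr prim; apply/funext => t; rewrite /N /force; ring.
have m2 : 0 <= T * mean u ^+ 2 by rewrite mulr_ge0 ?sqr_ge0// ltW.
move: Phi_vw; rewrite primB// parts /shape_energy /residual -/u.
by lra.
Qed.

(** Otherwise one step would go below the lower bound b. *)
Lemma almost_minimum_residual (e : R) : 0 < e -> exists2 d, 0 < d &
  forall b x v, (forall y w, adm w -> b <= energy y w) -> adm v ->
  energy x v < b + d -> residual x v < e.
Proof.
move=> e0; have e20 : 0 < e / 2 by rewrite divr_gt0.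
have [th /andP[th0 th1] H] := step_decrease P e20.
exists (th * (e / 2)); first exact: mulr_gt0.
move=> b x v Hb av Eb; have th01 : 0 <= th <= th by rewrite lexx ltW.
have := H th x v th01 av.
have := Hb (next_base th x v) _ (@next_slope_adm _ P th x v _ av).
rewrite th1 ltW// => /(_ isT) h1 h2.
rewrite ltNge; apply/negP => er.
have : th * (e / 2) <= th * (residual x v - e / 2).
  by rewrite ler_pM2l//; lra.
by lra.
Qed.

End MountainPass.

(** * A mountain pass between the two ends *)

Section Pass.
Variables (R : realType) (P : reduced_problem R).
Local Notation T := (period P).
Local Notation c := (speed P).
Local Notation B := (force_bound P).
Local Notation moment := (moment P).
Local Notation adm := (admissible P).
Local Notation energy := (energy P).
Local Notation residual := (residual P).
Local Notation drift := (drift P).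
Local Notation next_base := (next_base P).
Local Notation next_slope := (next_slope P).
Local Notation shape_energy := (shape_energy P).
Implicit Types (u v w : R -> R) (t s : R).

Definition step (th : R) (p : R * (R -> R)) : R * (R -> R) :=
  (next_base th p.1 p.2, next_slope th p.1 p.2).

Lemma iter_step_adm th n p : 0 <= th <= 1 -> adm p.2 ->
  adm (iter n (step th) p).2.
Proof. by move=> th01 ap; elim: n => //= n IH; exact: next_slope_adm. Qed.

Lemma iter_step_cont th n v (s : R) : 0 <= th <= 1 -> adm v ->
  forall e, 0 < e -> exists2 d, 0 < d & forall s', `|s - s'| < d ->
  forall t, 0 <= t <= T ->
  `|traj (iter n (step th) (s, v)).1 (iter n (step th) (s, v)).2 t -
    traj (iter n (step th) (s', v)).1 (iter n (step th) (s', v)).2 t| < e.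
Proof.
move=> th01 av; elim: n => [|n IH] e e0 /=.
  exists e => // s' ss t _; rewrite /traj.
  by rewrite (_ : _ - _ = s - s')//; ring.
have [d d0 Hd] := next_traj_unif P th01 e0.
have [d' d'0 Hd'] := IH d d0; exists d' => // s' ss t tT.
by apply: Hd => //; [exact: iter_step_adm|exact: iter_step_adm|exact: Hd'].
Qed.

Lemma iter_step_base_cont th n v : 0 <= th <= 1 -> adm v ->
  continuous (fun s => (iter n (step th) (s, v)).1).
Proof.
move=> th01 av s; apply/cvgrPdist_lt => e e0.
have [d d0 Hd] := @iter_step_cont th n v s th01 av e e0.
have T0 := period_gt0 P.
near=> s'; have := Hd s' _ 0; rewrite /traj !prim0 !addr0; apply.
  by near: s'; apply: cvgr_dist_lt.
by rewrite lexx ltW.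
Unshelve. all: by end_near. Qed.

(** The base point moves along a segment; a crossing of x0 would put a point of
    low energy on the wall. *)
Lemma step_keeps_side th x0 beta x v : 0 <= th -> adm v ->
  (forall w, adm w -> beta <= energy x0 w) ->
  (forall s, 0 <= s <= th -> adm (next_slope s x v)) ->
  (forall s, 0 <= s <= th -> energy (next_base s x v) (next_slope s x v) <
    beta) ->
  (x < x0 -> next_base th x v < x0) /\ (x0 < x -> x0 < next_base th x v).
Proof.
move=> th0 av wall an below.
have key : (x0 - x) * (x0 - next_base th x v) <= 0 -> x != x0 -> False.
  rewrite /next_base; set D := drift x v => h1 xx.
  have th_gt0 : 0 < th * D * (x0 - x).
    have : 0 < (x0 - x) ^+ 2 by rewrite exprn_even_gt0//= subr_eq0 eq_sym.
    by nra.
  have thDx : (x0 - x) ^+ 2 <= th * D * (x0 - x) by nra.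
  have D0 : D != 0.
    by apply/eqP => D0; move: th_gt0; rewrite D0 mulr0 mul0r ltxx.
  have th_pos : 0 < th.
    rewrite lt_neqAle th0 andbT; apply/eqP => th00.
    by move: th_gt0; rewrite -th00 !mul0r ltxx.
  (* the moment at which the base point would hit the wall *)
  pose s := (x0 - x) / D.
  have xs : next_base s x v = x0.
    by rewrite /next_base -/D /s divfK// addrC subrK.
  have D2 : 0 < D ^+ 2 by rewrite exprn_even_gt0.
  have sE : s * D ^+ 2 = (x0 - x) * D by rewrite /s; field.
  have sth : 0 <= s <= th.
    have DX : 0 < D * (x0 - x) by move: th_gt0; rewrite -mulrA pmulr_rgt0.
    apply/andP; split; first by rewrite -(ler_pM2r D2) mul0r sE; lra.
    rewrite -(ler_pM2r DX) (_ : s * (D * (x0 - x)) = (x0 - x) ^+ 2); last first.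
      by rewrite /s; field.
    by move: thDx; rewrite mulrA.
  have := below s sth; rewrite xs ltNge => /negP; apply.
  exact/wall/an.
split=> xx; rewrite ltNge; apply/negP => h2; apply: key.
- by rewrite mulr_ge0_le0 ?subr_ge0 ?subr_le0// ltW.
- by rewrite lt_eqF.
- by rewrite mulr_le0_ge0 ?subr_ge0 ?subr_le0// ltW.
- by rewrite gt_eqF.
Qed.

(** Iterate the step simultaneously from all points (s, v0) with s between x1
    and x2. If no point of energy at least beta - e had a small residual, a
    uniform number n of steps would bring the whole family below beta. The ends
    start below beta, so they stay below and never cross the wall over x0; by
    the intermediate value theorem some point of the family sits on the wall
    after n steps, where the energy is at least beta. *)
Lemma mountain_pass (beta x1 x0 x2 : R) v0 (e : R) : 0 < e -> adm v0 ->
  x1 < x0 -> x0 < x2 -> (forall v, adm v -> beta <= energy x0 v) ->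
  energy x1 v0 < beta -> energy x2 v0 < beta ->
  exists x v, [/\ adm v, beta - e <= energy x v & residual x v < e].
Proof.
move=> e0 av0 x10 x02 wall E1 E2.
apply: contrapT => nex.
have crit x v : adm v -> beta - e <= energy x v -> e <= residual x v.
  move=> av Ex; rewrite leNgt; apply/negP => rx.
  by apply: nex; exists x, v.
have e20 : 0 < e / 2 by rewrite divr_gt0.
have [th /andP[th0 th1] step_le] := step_decrease P e20.
have th01 : 0 <= th <= 1 by rewrite ltW.
have admn s x v : adm v -> 0 <= s <= th -> adm (next_slope s x v).
  move=> av /andP[s0 sth]; apply: next_slope_adm => //.
  by rewrite s0 (le_trans sth).
have drop s x v : adm v -> 0 <= s <= th -> beta - e <= energy x v ->
    energy (next_base s x v) (next_slope s x v) <= energy x v - s * (e / 2).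
  move=> av sth Ex; apply: (le_trans (step_le s x v sth av)).
  have := crit x v av Ex; case/andP: sth => s0 _ rx.
  by rewrite lerD2l lerN2 ler_wpM2l//; lra.
have low s x v : adm v -> 0 <= s <= th -> energy x v < beta - e ->
    energy (next_base s x v) (next_slope s x v) < beta - e / 2.
  move=> av sth Ex; apply: (le_lt_trans (step_le s x v sth av)).
  have := @residual_ge0 _ P x v av; case/andP: sth => s0 sth rx.
  have : - (e / 2) <= s * (residual x v - e / 2).
    by have := mulr_ge0 s0 rx; have := le_trans sth th1; nra.
  by lra.
have below s x v : adm v -> 0 <= s <= th -> energy x v < beta ->
    energy (next_base s x v) (next_slope s x v) < beta.
  move=> av sth Ex; have [h1|h1] := leP (beta - e) (energy x v).
    apply: (le_lt_trans (drop s x v av sth h1)).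
    case/andP: sth => s0 _; have := mulr_ge0 s0 (ltW e20); lra.
  by apply: (lt_trans (low s x v av sth h1)); lra.
pose p n s := iter n (step th) (s, v0).
have ap n s : adm (p n s).2 by exact: iter_step_adm.
have tht : 0 <= th <= th by rewrite lexx ltW.
have keep n s : energy s v0 < beta -> energy (p n s).1 (p n s).2 < beta.
  by move=> Es; elim: n => [//|n IH]; exact: (below _ _ _ (ap n s) tht IH).
have side n s : energy s v0 < beta ->
    (s < x0 -> (p n s).1 < x0) /\ (x0 < s -> x0 < (p n s).1).
  move=> Es; elim: n => [//|n [IH1 IH2]].
  have [||S1 S2] := @step_keeps_side th x0 beta (p n s).1 (p n s).2 (ltW th0)
    (ap n s) wall.
  - by move=> r; exact: admn.
  - by move=> r rth; apply: below => //; exact: keep.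
  - by split=> [/IH1|/IH2]; [exact: S1|exact: S2].
have fall n s : energy (p n s).1 (p n s).2 <= Num.max
    (energy s v0 - n%:R * (th * (e / 2))) (beta - e / 2).
  elim: n => [|n IH]; first by rewrite mul0r subr0 le_max lexx.
  have [h1|h1] := leP (beta - e) (energy (p n s).1 (p n s).2); last first.
    by rewrite le_max (ltW (low _ _ _ (ap n s) tht h1)) orbT.
  apply: (le_trans (drop _ _ _ (ap n s) tht h1)).
  move: IH; rewrite !le_max => /orP[IH|IH]; apply/orP; [left|right].
    by rewrite -[n.+1%:R]natr1; lra.
  by have := mulr_gt0 th0 e20; lra.
have [M HM] : exists M, forall s, x1 <= s <= x2 -> energy s v0 <= M.
  exists (shape_energy v0 + B * (`|x1| + `|x2| + c * T) * T) => s /andP[s1 s2].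
  rewrite energy_split// lerD2l (le_trans (ler_norm _))//.
  rewrite (le_trans (potential_bound _ av0))//.
  apply: ler_wpM2r; first exact/ltW/period_gt0.
  apply: ler_wpM2l; first exact: force_bound_ge0.
  rewrite lerD2r.
  rewrite ler_norml; have := ler_norm x2; have := ler_norm (- x1).
  by rewrite normrN; have := normr_ge0 x1; have := normr_ge0 x2; lra.
have the2 : 0 < th * (e / 2) by rewrite mulr_gt0.
pose n := Num.bound `|(M - beta) / (th * (e / 2))|.
have Mn : M - n%:R * (th * (e / 2)) < beta.
  rewrite ltrBlDl -ltrBlDr -ltr_pdivrMr//.
  by rewrite (le_lt_trans (ler_norm _))// archi_boundP.
have [S1 _] := side n x1 E1; have [_ S2] := side n x2 E2.
have x12 : x1 <= x2 by apply: ltW; exact: lt_trans x02.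
have [||s] := @IVT _ (fun s => (p n s).1) x1 x2 x0 x12.
- exact/continuous_subspaceT/iter_step_base_cont.
- by rewrite ge_min le_max (ltW (S1 x10)) (ltW (S2 x02)) orbT.
rewrite in_itv/= => sx ps.
have := wall _ (ap n s); rewrite -[in energy _ _]ps leNgt => /negP; apply.
apply: (le_lt_trans (fall n s)); rewrite gt_max; apply/andP; split; last by lra.
by apply: le_lt_trans Mn; rewrite lerD2r; exact: HM.
Qed.

(** The level m0 + a, with m0 the infimum of shape_energy, is the limit of the
    energy at the two ends: either some energy is below it, or energies near it
    occur over 0 while none is below it, or a wall stands above it. In each
    case the energy level of the almost critical points differs from m0 + a, or
    their base point is known. *)
Lemma bounded_almost_critical : exists M, forall e, 0 < e ->
  exists x v, [/\ adm v, `|x| <= M & residual x v < e].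
Proof.
have T0 := period_gt0 P; have c0 := speed_gt0 P.
have a0 : adm (fun _ => 0).
  split; [exact: cont_cst|by move=> t; rewrite normr0 ltW|].
  by rewrite prim_cst mul0r.
pose J := [set shape_energy v | v in [set v | adm v]].
have [m mJ] := shape_energy_lower P.
have infJ : has_inf J.
  by split; [exists (shape_energy (fun _ => 0)), (fun _ => 0)|
    exists m => _ [v av <-]; exact: mJ].
pose m0 := inf J.
have m0J v : adm v -> m0 <= shape_energy v.
  by move=> av; apply: ge_inf; [exact: infJ.2|exists v].
have m0near e : 0 < e -> exists2 v, adm v & shape_energy v < m0 + e.
  by move=> e0; have [_ [v av <-] ve] := inf_adherent e0 infJ; exists v.
pose a := potential_limit P * T.
have [[x1 [v1 [av1 Ev1]]]|none] :=
  pselect (exists x v, adm v /\ energy x v < m0 + a).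
  pose J' := [set e | exists x v, adm v /\ e = energy x v].
  have [M HM] := energy_far P (@ltr01 R).
  have infJ' : has_inf J'.
    split; first by exists (energy x1 v1), x1, v1.
    exists (Num.min (m + a - 1) (m - B * (M + c * T) * T)) => _ [x [v [av ->]]].
    rewrite ge_min; have [xM|xM] := leP `|x| M; apply/orP; [right|left].
      rewrite energy_split//; have := potential_bound x av.
      have : B * (`|x| + c * T) * T <= B * (M + c * T) * T.
        apply: ler_wpM2r; first exact: ltW.
        by apply: ler_wpM2l; rewrite ?force_bound_ge0// lerD2r.
      by rewrite ler_norml => h1 /andP[h2 _]; have := mJ v av; lra.
    have := HM x v av xM; rewrite ler_norml -/a => /andP[h1 _].
    by have := mJ v av; lra.
  pose b := inf J'.
  have bE x v : adm v -> b <= energy x v.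
    by move=> av; apply: ge_inf; [exact: infJ'.2|exists x, v].
  pose d := (m0 + a - b) / 3.
  have d0 : 0 < d by rewrite divr_gt0// subr_gt0 (le_lt_trans (bE x1 _ av1)).
  have [M' HM'] := energy_far P d0.
  exists M' => e e0; have [d' d'0 Hd'] := almost_minimum_residual P e0.
  have dd0 : 0 < Num.min d d' by rewrite lt_min d0.
  have [_ [x [v [av ->]]] Ex] := inf_adherent dd0 infJ'.
  have [Ed Ed'] : energy x v < b + d /\ energy x v < b + d'.
    by split; apply: (lt_le_trans Ex); rewrite lerD2l ge_min lexx ?orbT.
  exists x, v; split=> //; last exact: Hd' bE av Ed'.
  rewrite leNgt; apply/negP => xM; have := HM' x v av xM.
  rewrite ler_norml -/a => /andP[h1 _]; have := m0J v av.
  have : m0 + a - b = 3 * d by rewrite /d; field.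
  by lra.
have floor x v : adm v -> m0 + a <= energy x v.
  by move=> av; rewrite leNgt; apply/negP => Ex; apply: none; exists x, v.
have [[x0 [d [d0 wall]]]|nowall] := pselect (exists x0 d, 0 < d /\
    forall v, adm v -> m0 + a + d <= energy x0 v); last first.
  exists 0 => e e0; have [d d0 Hd] := almost_minimum_residual P e0.
  suff [v av Ev] : exists2 v, adm v & energy 0 v < m0 + a + d.
    by exists 0, v; split; rewrite ?normr0//; exact: Hd floor av Ev.
  apply: contrapT => nv; apply: nowall; exists 0, d; split=> // v av.
  by rewrite leNgt; apply/negP => Ev; apply: nv; exists v.
have d30 : 0 < d / 8 by rewrite divr_gt0.
have [w aw Jw] := m0near _ d30.
have [M1 HM1] := energy_far P d30; have [M2 HM2] := shape_energy_far P d30.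
exists (Num.max M1 M2) => e e0.
pose r := `|x0| + `|M1| + 1.
have r0 : M1 < r by rewrite /r; have := ler_norm M1; have := normr_ge0 x0; lra.
have xr : - r < x0 < r.
  by rewrite -ltr_norml /r; have := normr_ge0 M1; lra.
have rE : `|r| = r by rewrite ger0_norm// !addr_ge0.
have Er s : M1 < `|s| -> energy s w < m0 + a + d.
  by move=> /(HM1 s w aw); rewrite ler_norml -/a => /andP[_]; lra.
pose e' := Num.min e (d / 4).
have e'0 : 0 < e' by rewrite lt_min e0 divr_gt0.
have /andP[xr1 xr2] := xr.
have [||x [v [av Ex rx]]] := mountain_pass e'0 aw xr1 xr2 wall.
- by apply: Er; rewrite normrN rE.
- by apply: Er; rewrite rE.
have [e1 e2] : e' <= e /\ e' <= d / 4 by rewrite !ge_min !lexx orbT.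
exists x, v; split=> //; last exact: lt_le_trans rx e1.
rewrite leNgt; apply/negP; rewrite gt_max => /andP[x1 x2].
have := HM2 x v w av aw x2; have := HM1 x v av x1.
by rewrite ler_norml -/a => /andP[_]; lra.
Qed.

End Pass.

(** * Passage to the limit *)

Section Limit.
Variables (R : realType) (P : reduced_problem R).
Local Notation T := (period P).
Local Notation c := (speed P).
Local Notation mean := (mean P).
Local Notation moment := (moment P).
Local Notation shift := (shift P).
Local Notation shape := (shape P).
Local Notation adm := (admissible P).
Local Notation bregman := (bregman P).
Local Notation residual := (residual P).
Implicit Types (u v w : R -> R) (t s : R).

(** Along almost critical points v is close to shape u in the mean, by
    kinetic_sharp, and shape is continuous in u; a uniform cluster point of the
    trajectories therefore satisfies u' = shape u. *)
Lemma critical_point : exists u, [/\ continuous u, mean u = 0 &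
  forall t, 0 <= t <= T -> u t = u 0 + prim (shape u) t].
Proof.
have T0 := period_gt0 P; have c0 := speed_gt0 P;
  have [M HM] := bounded_almost_critical P.
have HMn n : exists p : R * (R -> R),
    [/\ adm p.2, `|p.1| <= M & residual p.1 p.2 < n.+1%:R^-1].
  have n0 : (0 : R) < n.+1%:R^-1 by rewrite invr_gt0 ltr0n.
  by have [x [v ?]] := HM _ n0; exists (x, v).
have [p Hp] := choice HMn; pose un n := traj (p n).1 (p n).2.
have ap n : adm (p n).2 by have [] := Hp n.
have cun n : continuous (un n) by exact: traj_cont.
have ulip n s t : `|un n s - un n t| <= c * `|s - t|.
  have [cv vc _] := ap n; rewrite /un /traj.
  have -> : (p n).1 + prim (p n).2 s - ((p n).1 + prim (p n).2 t) =
    prim (p n).2 s - prim (p n).2 t by ring.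
  exact: prim_lipschitz.
have u0 n : `|un n 0| <= M by rewrite /un /traj prim0 addr0; have [] := Hp n.
have [u llip Hu] := lipschitz_cluster T0 c0 ulip u0.
have cu : continuous u.
  move=> t; apply/cvgrPdist_lt => e e0; near=> s.
  apply: (le_lt_trans (llip t s)); rewrite -ltr_pdivlMl//.
  by near: s; apply: cvgr_dist_lt => //; rewrite mulr_gt0// invr_gt0.
have close e : 0 < e -> exists n, residual (p n).1 (p n).2 < e /\
    forall t, 0 <= t <= T -> `|un n t - u t| < e.
  move=> e0; have [n Nn un_u] := Hu e (Num.bound e^-1) e0.
  exists n; split=> //; have [_ _ /lt_trans] := Hp n; apply.
  rewrite invf_plt ?posrE//; apply: (lt_le_trans (archi_boundP _)).
    by rewrite invr_ge0 ltW.
  by rewrite ler_nat (leq_trans Nn).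
have near_shape e : 0 < e -> `|mean u| <= 2 * e /\
    forall t, 0 <= t <= T -> `|u t - (u 0 + prim (shape u) t)| <= (2 + 3 * T)
      * e.
  move=> e0; have [d d0 Hd] := shape_unif P e0;
    have [C C0 HC] := kinetic_sharp P e0.
  pose r := Num.min (Num.min e d) (Num.min (T * e ^+ 2) (e * T / (C + 1))).
  have C1 : 0 < C + 1 by rewrite ltr_wpDl.
  have r0 : 0 < r.
    by rewrite !lt_min e0 d0 /= mulr_gt0 ?exprn_gt0//= divr_gt0// mulr_gt0.
  have [n [res_n un_u]] := close r r0.
  have re : r <= e by rewrite /r !ge_min lexx.
  have rd : r <= d by rewrite /r !ge_min lexx orbT.
  have rT : r <= T * e ^+ 2 by rewrite /r !ge_min lexx !orbT.
  have rC : r <= e * T / (C + 1) by rewrite /r !ge_min lexx !orbT.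
  have un_d t : 0 <= t <= T -> `|un n t - u t| < d.
    by move=> /un_u/lt_le_trans; apply.
  have [mm SS] := Hd (un n) u (cun n) cu un_d.
  have cbr := bregman_cont (cun n) (ap n).
  have cS := @shape_cont _ P _ cu; have cSn := @shape_cont _ P _ (cun n).
  have br0 : 0 <= prim (bregman (un n) (p n).2) T.
    by apply: prim_ge0 => // t; exact: bregman_ge0.
  have m20 : 0 <= T * mean (un n) ^+ 2 by rewrite mulr_ge0 ?sqr_ge0// ltW.
  have resE : residual (p n).1 (p n).2 =
    prim (bregman (un n) (p n).2) T + T * mean (un n) ^+ 2 by [].
  have mn : `|mean (un n)| <= e.
    have : T * mean (un n) ^+ 2 <= T * e ^+ 2 by lra.
    rewrite ler_pM2l// -(real_normK (num_real (mean (un n)))).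
    by rewrite ler_pXn2r ?nnegrE// ltW.
  split.
    have := ler_normB (mean (un n)) (mean (un n) - mean u).
    by rewrite opprB addrC subrK; lra.
  move=> t tT; have [cv vc _] := ap n; set v := (p n).2 in cv vc *.
  have cvS := contB cv cSn; have cSS := contB cSn cS.
  have Snu : `|prim (fun s => shape (un n) s - shape u s) t| <= e * T.
    rewrite -prim_cst; apply: le_norm_prim => //; first exact: cont_cst.
    by move=> s /SS/ltW.
  have vS : `|prim (fun s => v s - shape (un n) s) t| <=
      e * T + C * prim (bregman (un n) v) T.
    rewrite -primZ// -prim_cst -primD//; [|exact: cont_cst|]; last first.
      by apply: contM => //; exact: cont_cst.
    apply: le_norm_prim => //.
      by apply: contD; [exact: cont_cst|apply: contM => //; exact: cont_cst].
    move=> s sT; apply: (HC (v s) (shift (un n) + moment (un n) s) (vc s)).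
    exact: shape_argument.
  have Cbr : C * prim (bregman (un n) v) T <= e * T.
    apply: (@le_trans _ _ ((C + 1) * r)).
      by apply: ler_pM => //; [rewrite lerDl|move: res_n; rewrite resE -/v;
        lra].
    by rewrite mulrC -ler_pdivlMr.
  have t0 : (0 : R) <= (0 : R) <= T by rewrite lexx ltW.
  have := un_u t tT; have := un_u 0 t0.
  have -> : u t - (u 0 + prim (shape u) t) = (un n 0 - u 0) - (un n t - u t) +
      (prim (fun s => v s - shape (un n) s) t +
       prim (fun s => shape (un n) s - shape u s) t).
    by rewrite !primB// /un /traj prim0 -/v; ring.
  have := ler_normD (un n 0 - u 0 - (un n t - u t))
    (prim (fun s => v s - shape (un n) s) t +
       prim (fun s => shape (un n) s - shape u s) t).
  have := ler_normD (prim (fun s => v s - shape (un n) s) t)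
    (prim (fun s => shape (un n) s - shape u s) t).
  have := ler_normB (un n 0 - u 0) (un n t - u t).
  by lra.
exists u; split=> //.
  apply/eqP; rewrite -normr_le0; apply/ler_addgt0Pl => e e0.
  have e20 : 0 < e / 2 by rewrite divr_gt0.
  by have [h1 _] := near_shape _ e20; rewrite addr0; lra.
move=> t tT; apply/eqP; rewrite -subr_eq0 -normr_le0;
  apply/ler_addgt0Pl => e e0.
have T2 : 0 < 2 + 3 * T by rewrite addr_gt0// mulr_gt0.
have e20 : 0 < e / (2 + 3 * T) by rewrite divr_gt0.
have [_ /(_ t tT)] := near_shape _ e20.
by rewrite mulrC divfK ?gt_eqF// addr0.
Unshelve. all: by end_near. Qed.

End Limit.

(** * Reduction of the periodic problem *)

Section Clamp.
Context {R : realType}.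
Variables lo hi : R.
Hypothesis lohi : lo <= hi.

Definition clamp (x : R) : R := Num.max lo (Num.min hi x).

Lemma clamp_itv x : lo <= clamp x <= hi.
Proof. by rewrite /clamp le_max lexx ge_max lohi ge_min lexx. Qed.

Lemma clamp_id x : lo <= x <= hi -> clamp x = x.
Proof. by move=> /andP[lx xh]; rewrite /clamp min_r// max_r. Qed.

Lemma clamp_lip x y : `|clamp x - clamp y| <= `|x - y|.
Proof.
rewrite /clamp; move: lohi => h.
by case: (leP hi x) => ?; case: (leP hi y) => ?; rewrite ?(max_r h);
  case: (leP lo x) => ?; case: (leP lo y) => ?; rewrite ler_norml;
    have := ler_norm (x - y); have := ler_norm (y - x);
  rewrite (distrC y); lra.
Qed.

End Clamp.

Section Nonlinearity.
Variables (R : realType) (T : R) (f : R -> R -> R).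
Hypothesis T0 : 0 < T.
Hypothesis f_cont : {within `[0, T] `*` setT,
  continuous (fun p : R * R => f p.1 p.2)}.
Hypothesis f_lim : cvg_abs_infty_unif `[0, T] f 0.

(** The nonlinearity frozen at its end values outside the period. *)
Definition extend (t : R) : R -> R := f (clamp 0 T t).

Lemma clamp_in t : `[0, T]%classic (clamp 0 T t).
Proof. by rewrite /= in_itv/= clamp_itv// ltW. Qed.

Lemma extend_cont : continuous (fun p : R * R => extend p.1 p.2).
Proof.
move=> p; apply/cvgrPdist_lt => e e0.
have Ap : (`[0, T] `*` setT) (clamp 0 T p.1, p.2) by split => //;
  exact: clamp_in.
have [d d0 Hd] := within_dist f_cont Ap e0.
apply/(@nbhs_ballP R (R * R)%type); exists d => //= q [/= q1 q2].
apply: (Hd (clamp 0 T q.1, q.2)); first by split => //; exact: clamp_in.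
split => //=; apply: le_lt_trans q1; exact/clamp_lip/ltW.
Qed.

Lemma extend_vanish (e : R) : 0 < e -> exists M, forall t s,
  M < `|s| -> `|extend t s| < e.
Proof.
move=> /f_lim[M HM]; exists M => t s Ms.
by have := HM _ s (clamp_in t) Ms; rewrite subr0.
Qed.

Lemma extend_bounded : exists2 b, 0 <= b & forall t s, `|extend t s| <= b.
Proof.
have [M HM] := extend_vanish ltr01.
have cA := compact_setX (@segment_compact _ 0 T) (@segment_compact _ (- M) M).
have [b b0 Hb] := continuous_compact_bounded cA extend_cont.
exists (b + 1); first exact: addr_ge0.
move=> t s; have [sM|Ms] := leP `|s| M; last first.
  by rewrite (le_trans (ltW (HM t s Ms)))// lerDr.
apply: (@le_trans _ _ b); last by rewrite lerDl.
have := Hb (clamp 0 T t, s); rewrite /extend /= (clamp_id (clamp_itv (ltW T0)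
  t)); apply.
by split; [exact: clamp_in|rewrite /= in_itv/= -ler_norml].
Qed.

(** On a bounded strip this is compactness; beyond it both values are small. *)
Lemma extend_unif (e : R) : 0 < e -> exists2 d, 0 < d & forall t t' s s',
  `|t - t'| < d -> `|s - s'| < d -> `|extend t s - extend t' s'| < e.
Proof.
move=> e0; have e20 : 0 < e / 2 by rewrite divr_gt0.
have [M HM] := extend_vanish e20; pose M1 := `|M| + 1.
have cA := compact_setX (@segment_compact _ 0 T) (@segment_compact _ (- M1) M1).
have [d d0 Hd] := heine_cantor cA extend_cont e0.
exists (Num.min d 1); first by rewrite lt_min d0 ltr01.
move=> t t' s s'; rewrite !lt_min => /andP[td _] /andP[sd s1].
have [sM|sM] := leP `|s| M1.
  have := Hd (clamp 0 T t, s) (clamp 0 T t', s').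
  rewrite /extend /= !(clamp_id (clamp_itv (ltW T0) _)); apply.
    by split; [exact: clamp_in|rewrite /= in_itv/= -ler_norml].
  by split=> //=; apply: le_lt_trans td; exact/clamp_lip/ltW.
have Ms : M < `|s| by rewrite (le_lt_trans _ sM)// /M1; have := ler_norm M; lra.
have Ms' : M < `|s'|.
  have := ler_normD (s - s') s'; rewrite subrK; move: sM; rewrite /M1.
  by have := ler_norm M; lra.
rewrite (le_lt_trans (ler_normB _ _))// (splitr e) ltrD//; exact: HM.
Qed.

End Nonlinearity.

Section Inverse.
Variables (R : realType) (a : R) (Phi : R -> R).
Local Notation phi := (derive1 Phi).
Hypothesis a0 : 0 < a.
Hypothesis Phi_derivable :
  forall x : R, `]- a, a[%classic x -> derivable Phi x 1.
Hypothesis phi_incr : forall x y : R, `]- a, a[%classic x ->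
  `]- a, a[%classic y -> x < y -> phi x < phi y.

Lemma Phi_continuous_at x : - a < x < a -> {for x, continuous Phi}.
Proof.
move=> xa; apply: differentiable_continuous; apply/derivable1_diffP.
by apply: Phi_derivable; rewrite /= in_itv.
Qed.

Lemma Phi_above_tangent p q : - a < p < a -> - a < q < a ->
  Phi p + phi p * (q - p) <= Phi q.
Proof.
move=> pa qa.
have key x y : - a < x < a -> - a < y < a -> x < y ->
    exists2 z, x < z < y & Phi y - Phi x = phi z * (y - x).
  move=> /andP[xa1 xa2] /andP[ya1 ya2] xy.
  have d z : z \in `]x, y[%R -> is_derive z 1 Phi (phi z).
    rewrite in_itv/= => /andP[xz zy]; rewrite derive1E.
    apply/derivableP/Phi_derivable; rewrite /= in_itv/=.
    by rewrite (lt_trans xa1) ?(lt_trans zy).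
  have cP : {within `[x, y], continuous Phi}.
    apply: derivable_within_continuous => z; rewrite in_itv/= => /andP[xz zy].
    apply: Phi_derivable; rewrite /= in_itv/=.
    by rewrite (lt_le_trans xa1) ?(le_lt_trans zy).
  by have [z] := MVT xy d cP; rewrite in_itv/=; exists z.
have inO z x y : - a < x < a -> - a < y < a -> x < z < y -> `]- a, a[%classic z.
  move=> /andP[x1 _] /andP[_ y2] /andP[xz zy].
  by rewrite /= in_itv/= (lt_trans x1) ?(lt_trans zy).
have inI z : - a < z < a -> `]- a, a[%classic z by rewrite /= in_itv.
have [pq|qp|->] := ltgtP p q; last by rewrite subrr mulr0 addr0.
- have [z zpq] := key p q pa qa pq.
  have zp := phi_incr (inI p pa) (inO z p q pa qa zpq) (andP zpq).1.
  have : phi p * (q - p) <= phi z * (q - p).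
    by rewrite ler_wpM2r ?subr_ge0 ?ltW.
  by lra.
- have [z zqp] := key q p qa pa qp.
  have zp := phi_incr (inO z q p qa pa zqp) (inI p pa) (andP zqp).2.
  have : phi z * (p - q) <= phi p * (p - q).
    by rewrite ler_wpM2r ?subr_ge0 ?ltW.
  by lra.
Qed.

Variable k : R -> R.
Hypothesis k_cont : continuous k.
Hypothesis k_in : forall y, - a < k y < a.
Hypothesis phi_k : forall y, phi (k y) = y.
Hypothesis k_phi : forall x, - a < x < a -> k (phi x) = x.

Lemma k_incr x y : x < y -> k x < k y.
Proof.
move=> xy; rewrite ltNge; apply/negP; rewrite le_eqVlt => /predU1P[E|kyx].
  by move: xy; rewrite -(phi_k x) -(phi_k y) E ltxx.
have := phi_incr _ _ kyx; rewrite !phi_k /= !in_itv/= => /(_ (k_in y) (k_in x)).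
by rewrite ltNge (ltW xy).
Qed.

(** The divergence of a strictly convex function grows at least linearly at a
    positive distance from the base point, uniformly over compact sets of
    slopes: halfway between, the derivative has already increased by an amount
    controlled by the uniform continuity of its inverse. *)
Lemma divergence_sharp (L c e : R) : 0 < c < a -> 0 < e ->
  exists2 C, 0 <= C & forall q x, `|q| <= c -> `|x| <= L -> `|k x| <= c ->
  `|q - k x| <= e + C * (Phi q - Phi (k x) - x * (q - k x)).
Proof.
move=> /andP[c0 ca] e0; have e20 : 0 < e / 2 by rewrite divr_gt0.
have [d d0 Hd] := heine_cantor (@segment_compact _ (- L) L) k_cont e20.
exists (4 * c / (d * e)); first by rewrite divr_ge0 ?mulr_ge0 ?ltW.
move=> q x; rewrite !ler_norml => qc xL kc; rewrite -ler_norml.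
have inA z : - c <= z <= c -> - a < z < a.
  by move=> /andP[z1 z2]; apply/andP; split; lra.
have xA : `[- L, L]%classic x by rewrite /= in_itv.
set p := k x in kc *; set D := Phi q - Phi p - x * (q - p).
have phix : phi p = x by rewrite /p phi_k.
have D0 : 0 <= D.
  have := Phi_above_tangent (inA p kc) (inA q qc); rewrite phix /D; lra.
have C0 : 0 <= 4 * c / (d * e) by rewrite divr_ge0 ?mulr_ge0 ?ltW.
suff big : e < `|q - p| -> d * (e / 2) <= D.
  have [h|/big h] := leP `|q - p| e;
    first by rewrite (le_trans h)// lerDl mulr_ge0.
  apply: (@le_trans _ _ (2 * c)).
    rewrite ler_norml; move: qc kc => /andP[q1 q2] /andP[p1 p2].
    by apply/andP; split; lra.
  apply: (@le_trans _ _ (4 * c / (d * e) * (d * (e / 2)))).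
    rewrite (_ : _ * (d * _) = 2 * c)//; field; rewrite !gt_eqF//.
  have := ler_wpM2l C0 (h); lra.
have far m : - c <= m <= c -> `|p - m| = e / 2 -> d <= `|phi m - x|.
  move=> mc pm; rewrite leNgt; apply/negP => mx.
  have := Hd x (phi m) xA; rewrite /ball/= distrC => /(_ mx).
  by rewrite k_phi ?inA// -/p pm ltxx.
move: (qc) (kc) => /andP[q1 q2] /andP[p1 p2].
have [qp|qp] := leP p q.
- rewrite ger0_norm ?subr_ge0// => eqp; pose m := p + e / 2.
  have mc : - c <= m <= c by rewrite /m; apply/andP; split; lra.
  have dm : d <= phi m - x.
    have pm : `|p - m| = e / 2 by rewrite /m opprD addNKr normrN gtr0_norm.
    have := far m mc pm; rewrite gtr0_norm// subr_gt0 -phix.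
    by apply: phi_incr; rewrite /= ?in_itv ?inA// /m ltrDl.
  have h1 := Phi_above_tangent (inA m mc) (inA q qc).
  have h2 := Phi_above_tangent (inA p kc) (inA m mc); rewrite phix in h2.
  have h3 : d * (e / 2) <= (phi m - x) * (q - m).
    by apply: ler_pM => //; rewrite ?ltW// /m; lra.
  by rewrite /D; lra.
- rewrite ltr0_norm ?subr_lt0// => eqp; pose m := p - e / 2.
  have mc : - c <= m <= c by rewrite /m; apply/andP; split; lra.
  have dm : d <= x - phi m.
    have pm : `|p - m| = e / 2 by rewrite /m opprB addrC subrK gtr0_norm.
    have := far m mc pm; rewrite ltr0_norm ?opprB// subr_lt0 -phix.
    by apply: phi_incr; rewrite /= ?in_itv ?inA// /m gtrBl.
  have h1 := Phi_above_tangent (inA m mc) (inA q qc).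
  have h2 := Phi_above_tangent (inA p kc) (inA m mc); rewrite phix in h2.
  have h3 : d * (e / 2) <= (x - phi m) * (m - q).
    by apply: ler_pM => //; rewrite ?ltW// /m; lra.
  by rewrite /D; lra.
Qed.

End Inverse.

(** Only the behaviour of phi on the compact range of its inverse over
    [- 4 b T, 4 b T] survives the reduction; the added 1 in b keeps this range
    nondegenerate when both f and h vanish. *)
Lemma reduced_problem_exists (R : realType) (T0 a : R)
    (hT : 0 < T0) (ha : 0 < a)
    (Phi : R -> R)
    (Phi_derivable : forall x : R, `]- a, a[%classic x -> derivable Phi x 1)
    (phi_homeo : homeomorphism_on `]- a, a[ setT (derive1 Phi))
    (phi_incr : forall x y : R, `]- a, a[%classic x -> `]- a, a[%classic y ->
       x < y -> derive1 Phi x < derive1 Phi y)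
    (phi_0 : derive1 Phi 0 = 0)
    (f : R -> R -> R)
    (f_cont : {within `[0, T0] `*` setT,
       continuous (fun p : R * R => f p.1 p.2)})
    (f_lim : cvg_abs_infty_unif `[0, T0] f 0)
    (F_lim : exists alpha : R, cvg_abs_infty_unif `[0, T0] (primitive f) alpha)
    (h : R -> R)
    (h_cont : {within `[0, T0], continuous h})
    (h_mean0 : (\int[lebesgue_measure]_(t in `[0, T0]) h t)%R = 0) :
  exists P : reduced_problem R, [/\ period P = T0, speed P < a,
    (forall x, `|x| <= 4 * force_bound P * period P ->
      derive1 Phi (slope P x) = x),
    (forall t s, 0 <= t <= T0 -> nonlinearity P t s = f t s) &
    (forall t, 0 <= t <= T0 -> forcing P t = h t)].
Proof.
have [_ [k [k_cont0 kphi phik]]] := phi_homeo.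
have k_cont : continuous k by exact/continuous_subspace_setT.
have k_in y : - a < k y < a by have [] := phik y I; rewrite /= in_itv.
have phi_k y : derive1 Phi (k y) = y by have [] := phik y I.
have k_phi x : - a < x < a -> k (derive1 Phi x) = x.
  by move=> xa; have [] := kphi x; rewrite /= ?in_itv.
have kI := k_incr phi_incr k_in phi_k.
have inI z : - a < z < a -> `]- a, a[%classic z by rewrite /= in_itv.
have [bf bf0 Hbf] := extend_bounded hT f_cont f_lim.
pose hh t := h (clamp 0 T0 t).
have T0' := ltW hT.
have hh_cont : continuous hh.
  move=> t; apply/cvgrPdist_lt => e e0.
  have tA : `[0, T0]%classic (clamp 0 T0 t) by exact: clamp_in.
  have [d d0 Hd] := within_dist h_cont tA e0.
  near=> s; apply: Hd; first exact: clamp_in.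
  apply: (le_lt_trans (clamp_lip T0' t s)).
  by near: s; apply: cvgr_dist_lt.
have [bh bh0 Hbh'] := continuous_compact_bounded (@segment_compact _ 0 T0)
  hh_cont.
have Hbh t : `|hh t| <= bh.
  have := Hbh' (clamp 0 T0 t) (clamp_in hT t).
  by rewrite /hh (clamp_id (clamp_itv T0' t)).
pose b := bf + bh + 1.
have b0 : 0 < b by rewrite ltr_wpDl// addr_ge0.
pose L := 4 * b * T0; have L0 : 0 < L by rewrite !mulr_gt0.
have NL : - L <= L by rewrite ge0_cp// ltW.
pose KK x := k (clamp (- L) L x).
have k00 : k 0 = 0.
  by rewrite -[X in k X]phi_0 k_phi// oppr_lt0 ha.
have kL : 0 < k L by rewrite -k00 kI.
have kNL : k (- L) < 0 by rewrite -k00 kI// oppr_lt0.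
pose cc := Num.max (k L) (- k (- L)).
have cc0 : 0 < cc by rewrite lt_max kL.
have cca : cc < a.
  rewrite gt_max; have /andP[_ ->] := k_in L; have /andP[h1 _] := k_in (- L).
  by rewrite ltrNl.
have kle x y : x <= y -> k x <= k y.
  by rewrite le_eqVlt => /predU1P[->//|/kI/ltW].
have KKid x : `|x| <= L -> KK x = k x.
  by rewrite ler_norml => xL; rewrite /KK clamp_id.
have KKc x : `|KK x| <= cc.
  have /andP[x1 x2] := clamp_itv NL x; rewrite ler_norml /KK /cc.
  rewrite le_max kle ?orbT// andbT lerNl le_max lerN2 kle// orbT//.
have accin q : `|q| <= cc -> - a < q < a.
  by move=> qc; rewrite -ltr_norml (le_lt_trans qc).
have tangent := Phi_above_tangent Phi_derivable phi_incr.
have [al Hal] := F_lim.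
unshelve eexists (@ReducedProblem R T0 cc b KK Phi (extend T0 f) hh al
  hT cc0 (ltW b0) _ _ _ KKc _ _ _ _ _ _ _ _ hh_cont _ _).
- move=> e e0; have [d d0 Hd] :=
    heine_cantor (@segment_compact _ (- L) L) k_cont e0.
  exists d => // x y xy; apply: Hd; first by rewrite /= in_itv/= clamp_itv.
  exact: le_lt_trans (clamp_lip NL x y) xy.
- by rewrite KKid ?normr0 ?ltW.
- move=> x y xL xy yL; rewrite !KKid; first exact: kI.
  + by rewrite ler_norml yL (le_trans xL)// ltW.
  + by rewrite ler_norml xL (le_trans (ltW xy)).
- move=> v cv vc t; apply: continuous_comp; first exact: cv.
  exact/(Phi_continuous_at Phi_derivable)/accin.
- move=> th p q /andP[th0 th1] pc qc; set m := p + th * (q - p).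
  have mc : `|m| <= cc.
    have -> : m = (1 - th) * p + th * q by rewrite /m; ring.
    rewrite (le_trans (ler_normD _ _))// !normrM (ger0_norm th0).
    rewrite ger0_norm ?subr_ge0// (_ : cc = (1 - th) * cc + th * cc);
      last by ring.
    by rewrite lerD// ler_wpM2l// subr_ge0.
  have tp := tangent m p (accin m mc) (accin p pc).
  have tq := tangent m q (accin m mc) (accin q qc).
  have th1' : 0 <= 1 - th by rewrite subr_ge0.
  have h1 := ler_wpM2l th1' tp; have h2 := ler_wpM2l th0 tq.
  have h3 : (1 - th) * (p - m) + th * (q - m) = 0 by rewrite /m; ring.
  have h4 : derive1 Phi m * ((1 - th) * (p - m) + th * (q - m)) = 0.
    by rewrite h3 mulr0.
  by move: h1 h2 h4; lra.
- move=> q x qc xL; rewrite KKid//.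
  have := tangent (k x) q (k_in x) (accin q qc); rewrite phi_k; lra.
- move=> e e0; have cca' : 0 < cc < a by rewrite cc0.
  have [C C0 HC] := divergence_sharp Phi_derivable phi_incr k_cont
    phi_k k_phi L cca' e0.
  exists C => // q x qc xL; have := KKc x; rewrite KKid// => kc.
  exact: HC.
- by move=> e e0; exact: (extend_unif hT f_cont f_lim e0).
- by move=> t s; rewrite (le_trans (Hbf t s))// /b -addrA lerDl addr_ge0.
- by move=> e e0; exact: extend_vanish e0.
- move=> e /Hal[M HM]; exists M => t s Ms; rewrite prim.unlock.
  exact: (HM _ s (clamp_in hT t) Ms).
- rewrite prim.unlock /oriented_integral T0'; apply: etrans h_mean0.
  apply: eq_Rintegral => t; rewrite inE/= in_itv/= => tT.
  by rewrite /hh clamp_id.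
- move=> t s; rewrite (le_trans (ler_normD _ _))// /b -addrA lerD//.
  by rewrite (le_trans (Hbh t))// lerDl.
split=> //=.
- by move=> x xL; rewrite KKid.
- by move=> t s tT; rewrite /extend clamp_id.
- by move=> t tT; rewrite /hh clamp_id.
Unshelve. all: by end_near. Qed.

(** * Solutions in the classical sense *)

Section DeriveWithin.
Variables (R : realType) (T : R).
Hypothesis T0 : 0 < T.
Implicit Types (u : R -> R) (t l : R).

(** Uniqueness of the one-sided limits at the ends of the segment. *)
Lemma punctured_segment_proper t : 0 <= t <= T ->
  ProperFilter (within `[0, T]%classic t^').
Proof.
move=> /andP[t0 tT]; apply: Build_ProperFilter_ex => A /nbhs_ballP[d /= d0 Hd].
have [tltT|] := ltP t T.
  pose r := Num.min d (T - t) / 2.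
  have r0 : 0 < r by rewrite divr_gt0// lt_min d0 subr_gt0.
  have [rd rT] : r < d /\ r < T - t.
    have h0 : 0 < Num.min d (T - t) by rewrite lt_min d0 subr_gt0.
    have h1 : Num.min d (T - t) <= d by rewrite ge_min lexx.
    have h2 : Num.min d (T - t) <= T - t by rewrite ge_min lexx orbT.
    by rewrite /r; lra.
  exists (t + r); apply: Hd; rewrite /ball/=.
  - by rewrite opprD addNKr normrN gtr0_norm.
  - by rewrite gt_eqF// ltrDl.
  - by rewrite in_itv/=; apply/andP; split; lra.
move=> Tt; pose r := Num.min d t / 2.
have h0 : 0 < Num.min d t by rewrite lt_min d0 (lt_le_trans T0).
have [r0 [rd rt]] : 0 < r /\ r < d /\ r < t.
  have h1 : Num.min d t <= d by rewrite ge_min lexx.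
  have h2 : Num.min d t <= t by rewrite ge_min lexx orbT.
  by rewrite /r; lra.
exists (t - r); apply: Hd; rewrite /ball/=.
- by rewrite opprB addrC subrK gtr0_norm.
- by rewrite lt_eqF// gtrBl.
- by rewrite in_itv/=; apply/andP; split; lra.
Qed.

Lemma diff_quot_cvg u t l : is_derive t 1 u l ->
  diff_quot u t s @[s --> within `[0, T]%classic t^'] --> l.
Proof.
move=> du; have dv : derivable u t 1 by [].
have uE : 'D_1 u t = l by exact: derive_val.
apply/cvgrPdist_lt => e e0; move: dv; rewrite /derivable => /cvgrPdist_lt.
rewrite -/('D_1 u t) uE => /(_ e e0) /nbhs_ballP[d /= d0 Hd].
apply/nbhs_ballP; exists d => // s /= ts st _.
have := Hd (s - t); rewrite /ball/= sub0r opprB => /(_ ts).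
rewrite subr_eq0 => /(_ st); congr (`|_ - _| < _).
rewrite /diff_quot /GRing.scale/= mulr1 subrK mulrC//.
Qed.

Lemma derive_withinE u t l : 0 <= t <= T -> is_derive t 1 u l ->
  derivable_within `[0, T] u t /\ derive_within `[0, T] u t = l.
Proof.
move=> tT du; have cu := diff_quot_cvg du; split.
  by apply/cvg_ex; exists l.
have pF := punctured_segment_proper tT.
by apply: cvg_lim cu; exact: Rhausdorff.
Qed.

End DeriveWithin.

Lemma lipschitz_absolutely_continuous (R : realType) (p q L : R) (g : R -> R) :
  0 <= L -> (forall x y, p <= x <= q -> p <= y <= q ->
    `|g y - g x| <= L * `|y - x|) ->
  absolutely_continuous p q g.
Proof.
move=> L0 gL e e0; exists (e / (L + 1)); first by rewrite divr_gt0// ltr_wpDl.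
move=> n x y xy _ sxy.
apply: (@le_lt_trans _ _ (L * \sum_(i < n) (y i - x i))).
  rewrite mulr_sumr; apply: ler_sum => i _.
  have [px [xi yq]] := xy i.
  rewrite -[leRHS](_ : L * `|y i - x i| = _);
    last by rewrite ger0_norm ?subr_ge0.
  by apply: gL; rewrite ?px ?yq ?andbT ?(le_trans xi)// (le_trans px).
have s0 : 0 <= \sum_(i < n) (y i - x i).
  by apply: sumr_ge0 => i _; have [_ [xi _]] := xy i; rewrite subr_ge0.
move: sxy; rewrite ltr_pdivlMr ?ltr_wpDl// => sxy.
by apply: le_lt_trans sxy; rewrite mulrDr mulr1 mulrC lerDl.
Qed.

Theorem theorem2p1 (R : realType) (T a : R) (hT : 0 < T) (ha : 0 < a)
    (Phi : R -> R)
    (Phi_cont : {within `[- a, a], continuous Phi})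
    (Phi_derivable : forall x : R, `]- a, a[%classic x -> derivable Phi x 1)
    (Phi_C1 : {within `]- a, a[, continuous (derive1 Phi)})
    (phi_homeo : homeomorphism_on `]- a, a[ setT (derive1 Phi))
    (phi_incr : forall x y : R, `]- a, a[%classic x -> `]- a, a[%classic y ->
       x < y -> derive1 Phi x < derive1 Phi y)
    (phi_0 : derive1 Phi 0 = 0)
    (f : R -> R -> R)
    (f_cont : {within `[0, T] `*` setT,
       continuous (fun p : R * R => f p.1 p.2)})
    (f_lim : cvg_abs_infty_unif `[0, T] f 0)
    (F_lim : exists alpha : R, cvg_abs_infty_unif `[0, T] (primitive f) alpha)
    (h : R -> R)
    (h_cont : {within `[0, T], continuous h})
    (h_mean0 : (\int[lebesgue_measure]_(t in `[0, T]) h t)%R = 0) :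
  exists u : R -> R, periodic_solution T a (derive1 Phi) f h u.
Proof.
have [P [TE ca phiK fE hE]] := reduced_problem_exists hT ha Phi_derivable
  phi_homeo phi_incr
  phi_0 f_cont f_lim F_lim h_cont h_mean0.
rewrite -TE in hT fE hE * => {TE}.
have [u [cu mu0 uE]] := critical_point P.
have cS := @shape_cont _ P _ cu; have cE := @moment_cont _ P _ cu.
have momE t : moment P u t = prim (force P u) t.
  by rewrite /moment mu0; congr prim; apply/funext => s; rewrite subr0.
have cg := @force_cont _ P _ cu.
exists (fun t => u 0 + prim (shape P u) t).
set w := fun t => _; have w0 : w 0 = u 0 by rewrite /w prim0 addr0.
have uw t : 0 <= t <= period P -> w t = u t by move=> /uE ->.
have dw (t : R) : is_derive t 1 w (shape P u t).
  have dp := is_derive_prim t cS.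
  have dc : is_derive t 1 (cst (u 0) + prim (shape P u)) (0 + shape P u t).
    exact: is_deriveD.
  by rewrite add0r in dc.
have dwE t : 0 <= t <= period P -> derivable_within `[0, period P] w t /\
    derive_within `[0, period P] w t = shape P u t.
  by move=> tT; exact: derive_withinE.
have phi_shape t : 0 <= t <= period P ->
    derive1 Phi (shape P u t) = shift P u + moment P u t.
  by move=> tT; rewrite /shape phiK//; exact: shape_argument.
have I0 : 0 <= (0 : R) <= period P by rewrite lexx ltW.
have IT : 0 <= period P <= period P by rewrite lexx ltW.
rewrite /periodic_solution /=; split.
- split; first by move=> t; rewrite /= in_itv/= => /dwE[].
  apply: (@subspace_eq_continuous _ `[0, period P] _ (shape P u)).
    by move=> t; rewrite inE/= in_itv/= => /dwE[_ /esym].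
  exact: continuous_subspaceT.
- split; first by rewrite w0 /w; have [_ ->] := shiftP P cu; rewrite addr0.
  rewrite (dwE _ I0).2 (dwE _ IT).2 /shape !momE prim0.
  by rewrite -momE moment_per.
- apply: le_lt_trans ca; apply: ge_sup.
    by exists `|derive_within `[0, period P] w 0|, 0 => //=; rewrite in_itv.
  move=> r [t /=]; rewrite in_itv/= => /dwE[_ ->] <-; exact: shape_bound.
- apply: (@lipschitz_absolutely_continuous _ _ _ (force_bound P));
  first exact: force_bound_ge0.
  move=> x y xT yT; rewrite /= (dwE _ xT).2 (dwE _ yT).2 !phi_shape// !momE.
  rewrite opprD addrACA subrr add0r.
  by apply: prim_lipschitz => // s; exact: force_le.
- apply: aeW => t; rewrite /= in_itv/= => /andP[t0 tT].
  have tT' : 0 <= t <= period P by rewrite !ltW.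
  have -> : f t (w t) + h t = 0 + force P u t.
    by rewrite uw// add0r /force fE// hE.
  have dg := is_derive_prim t cg.
  have dc : is_derive t 1 (cst (shift P u) + prim (force P u)) (0 + force P u
    t).
    exact: is_deriveD.
  apply: near_eq_is_derive dc; near=> s.
  have sT : 0 <= s <= period P.
    apply/andP; split; apply: ltW; near: s; [exact: lt_nbhsr|exact: lt_nbhsl].
  by rewrite /= (dwE _ sT).2 phi_shape// momE.
Unshelve. all: by end_near. Qed.
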